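(* Let $\nu\subseteq\mu$ be strict partitions. Then \[ GQ_{\mu/\!\!/\nu}=\sum_{(\kappa,\lambda)} 2^{\ell(\mu)-\ell(\nu)+\mathsf{overlap}(\nu/\kappa)}(-1)^{\mathsf{cols}(\lambda/\mu)}(-\beta/2)^{|\nu/\kappa|+|\lambda/\mu|}\, GP_{\lambda/\!\!/\kappa}, \] where the sum is over all pairs of strict partitions $(\kappa,\lambda)$ with $\kappa\subseteq\nu\subseteq\mu\subseteq\lambda$, $\ell(\kappa)=\ell(\nu)\le\ell(\mu)=\ell(\lambda)$, and $\mathsf{SD}_{\lambda/\mu}$ a vertical strip.
   Context: A strict partition is a finite strictly decreasing sequence $\lambda=(\lambda_1>\dots>\lambda_\ell>0)$ of positive integers (possibly empty); $\ell(\lambda)=\ell$, $|\lambda|=\sum\lambda_i$. $\mathsf{SD}_\lambda=\{(i,j)\in\mathbb{Z}^2:0<i\le j<i+\lambda_i\}$ (boxes $(j,j)$ are diagonal). $\mu\subseteq\lambda$ means $\mu_i\le\lambda_i$ for all $i$; then $\mathsf{SD}_{\lambda/\mu}=\mathsf{SD}_\lambda\setminus\mathsf{SD}_\mu$, $|\lambda/\mu|=|\mathsf{SD}_{\lambda/\mu}|$, $\mathsf{cols}(\lambda/\mu)$ is the number of distinct column indices $j$ of boxes of $\mathsf{SD}_{\lambda/\mu}$, $\mathsf{overlap}(\lambda/\mu):=|\{(i,j)\in\mathsf{SD}_{\lambda/\mu}:(i-1,j)\in\mathsf{SD}_{\lambda/\mu}\}|$, and $\mathsf{SD}_{\lambda/\mu}$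 is a vertical strip if it has at most one box in each row. Let $i'=i-\tfrac12$, ordering $1'<1<2'<2<\cdots$. A semistandard set-valued shifted tableau of shape $\lambda/\mu$ is a filling $T$ of $\mathsf{SD}_{\lambda/\mu}$ by nonempty finite sets of positive half-integers such that rows and columns weakly increase ($S\le S'$ iff $\max S\le\min S'$), no unprimed number occurs in two boxes of a column, and no primed number occurs in two boxes of a row. $\mathrm{SetShYT}_Q(\lambda/\mu)$ is the set of these, $\mathrm{SetShYT}_P(\lambda/\mu)$ those with no primed number in a diagonal box; $x^T=\prod x_i^{m_i}$ with $m_i$ the total number of occurrences of $i$ or $i'$; $|T|$ is the total number of elements in all entries. $GP_{\lambda/\mu}=\sum_{T\in\mathrm{SetShYT}_P(\lambda/\mu)}\beta^{|T|-|\lambda/\mu|}x^T$, $GQ_{\lambda/\mu}$ likewise with $\mathrm{SetShYT}_Q$; both are $0$ if $\mu\not\subseteq\lambda$. A box $(i,j)\in\mathsf{SD}_\mu$ is removable if $\mathsf{SD}_\mu\setminus\{(i,j)\}$ is the shifted diagram of a strict partition; $\mathsf{Rem}(\mu)$ is the set of removable boxes. For strict $\mu\subseteq\lambda$, $GP_{\lambda/\!\!/\mu}:=\sum_{\nu}\beta^{|\mu/\nu|}GP_{\lambda/\nu}$ and $GQ_{\lambda/\!\!/\mu}:=\sum_\nu\beta^{|\mu/\nu|}GQ_{\lambda/\nu}$, summing over strict partitions $\nu\subseteq\mu$ with $\mathsf{SD}_{\mu/\nu}\subseteq\mathsf{Rem}(\mu)$; these are $0$ if $\mu\not\subseteq\lambda$.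 *)

(* Defs.v *)
From HB Require Import structures.
From mathcomp Require Import all_boot all_order all_algebra.
From mathcomp Require Import finmap.
From mathcomp Require Import boolp classical_sets functions cardinality fsbigop.

Set Implicit Arguments.
Unset Strict Implicit.
Unset Printing Implicit Defensive.
Import GRing.Theory.

Local Open Scope classical_set_scope.
Local Open Scope fset_scope.
Local Open Scope ring_scope.

Definition is_strict_part (s : seq nat) : bool := sorted gtn s && (0%N \notin s).

Record spart := SPart { parts :> seq nat; _ : is_strict_part parts }.
HB.instance Definition _ := [isSub for parts].
HB.instance Definition _ := [Choice of spart by <:].

(* 1-based: part lam i is lambda_i, equal to 0 beyond the length *)
Definition part (lam : spart) (i : nat) : nat := nth 0%N lam i.-1.

Definition ell (lam : spart) : nat := size lam.

Definition SD (lam : spart) : {fset nat * nat} :=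
  [fset b in [seq (i, j) | i <- iota 1 (ell lam), j <- iota i (part lam i)]].

Lemma in_SD (lam : spart) (i j : nat) :
  ((i, j) \in SD lam) = (0 < i)%N && (i <= j < i + part lam i)%N.
Proof.
rewrite !inE; apply/allpairsPdep/idP => /=.
  move=> [a [b []]]; rewrite !mem_iota => /andP[a0 _] hb [-> ->].
  by rewrite a0.
move=> /andP[i0 /andP[ij jl]]; exists i, j.
split=> //; rewrite mem_iota ?ij // i0 /= add1n ltnS leqNgt.
apply/negP => li.
by move: jl; rewrite /part nth_default ?addn0 ?ltnNge ?ij // -ltnS prednK.
Qed.

Definition spsub (mu lam : spart) : Prop :=
  forall i, (0 < i)%N -> (part mu i <= part lam i)%N.

Definition skewSD (lam mu : spart) : {fset nat * nat} := SD lam `\` SD mu.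

Definition skew_size (lam mu : spart) : nat := #|` skewSD lam mu|.

Definition cols (lam mu : spart) : nat := #|` [fset b.2 | b in skewSD lam mu]|.

(* For b.1 = 1 the box (b.1.-1, b.2) = (0, b.2) lies in no diagram *)
Definition overlap (lam mu : spart) : nat :=
  #|` [fset b in skewSD lam mu | (b.1.-1, b.2) \in skewSD lam mu]|.

Definition vertical_strip (lam mu : spart) : Prop :=
  {in skewSD lam mu &, forall b c, b.1 = c.1 -> b = c}.

Definition removable (mu : spart) (b : nat * nat) : Prop :=
  b \in SD mu /\ exists rho : spart, SD rho = SD mu `\ b.

(* The positive half-integer h is encoded by the natural number a = 2 h > 0:
   the unprimed number i is 2 i and i' = i - 1/2 is 2 i - 1. *)
Definition primed (a : nat) : bool := odd a.
Definition letter_index (a : nat) : nat := uphalf a.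

(* Entries outside the shape are empty *)
Definition filling := {fsfun nat * nat -> {fset nat} with fset0}.

(* max S <= min S', for nonempty S and S' *)
Definition fset_le (S S' : {fset nat}) : Prop :=
  {in S & S', forall a b, (a <= b)%N}.

Definition SetShYT_Q (lam mu : spart) (T : filling) : Prop :=
  let D := skewSD lam mu in
  [/\ finsupp T = D,
      (forall b, b \in D -> 0%N \notin T b),
      {in D &, forall b c, b.1 = c.1 -> (b.2 < c.2)%N -> fset_le (T b) (T c)} /\
      {in D &, forall b c, b.2 = c.2 -> (b.1 < c.1)%N -> fset_le (T b) (T c)},
      {in D &, forall b c, b.2 = c.2 -> b <> c ->
         forall a, ~~ primed a -> ~ (a \in T b /\ a \in T c)}
    & {in D &, forall b c, b.1 = c.1 -> b <> c ->
         forall a, primed a -> ~ (a \in T b /\ a \in T c)}].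

Definition SetShYT_P (lam mu : spart) (T : filling) : Prop :=
  SetShYT_Q lam mu T /\
  forall j, (j, j) \in skewSD lam mu -> forall a, a \in T (j, j) -> ~~ primed a.

Definition tab_size (T : filling) : nat := \sum_(b <- finsupp T) #|` T b|.

Definition tab_mult (T : filling) (i : nat) : nat :=
  \sum_(b <- finsupp T) #|` [fset a in T b | letter_index a == i]|.

(* m : monom stands for the product of the x_i ^ (m i) *)
Definition monom := {fsfun nat -> nat with 0%N}.

Definition has_monom (T : filling) (m : monom) : Prop :=
  forall i, m i = tab_mult T i.

(* Formal power series in x_1, x_2, ... over Q[beta], given by their
   coefficients; sums and scalar multiples are those of functions. *)
Definition fps := monom -> {poly rat}^o.
HB.instance Definition _ := GRing.Lmodule.on fps.

Definition beta : {poly rat} := 'X.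

(* Sums over sets, \sum_(t \in A), have finite support everywhere below;
   this is what the finiteness lemmas at the end of the file assert. *)
Definition tab_gf (A : set filling) (n : nat) : fps := fun m =>
  \sum_(T \in [set T | A T /\ has_monom T m]) beta ^+ (tab_size T - n).

Definition GP (lam mu : spart) : fps :=
  if `[< spsub mu lam >] then tab_gf (SetShYT_P lam mu) (skew_size lam mu) else 0.

Definition GQ (lam mu : spart) : fps :=
  if `[< spsub mu lam >] then tab_gf (SetShYT_Q lam mu) (skew_size lam mu) else 0.

Definition rem_sub (mu : spart) : set spart :=
  [set nu | spsub nu mu /\ (forall b, b \in skewSD mu nu -> removable mu b)].

(* GP_{lam // mu} and GQ_{lam // mu} *)
Definition GPP (lam mu : spart) : fps :=
  if `[< spsub mu lam >]
  then \sum_(nu \in rem_sub mu) beta ^+ skew_size mu nu *: GP lam nu else 0.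

Definition GQQ (lam mu : spart) : fps :=
  if `[< spsub mu lam >]
  then \sum_(nu \in rem_sub mu) beta ^+ skew_size mu nu *: GQ lam nu else 0.

(* The pairs (kappa, lambda) indexing the expansion of GQ_{mu // nu} *)
Definition expansion_pairs (mu nu : spart) : set (spart * spart) :=
  [set kl | [/\ spsub kl.1 nu, spsub nu mu & spsub mu kl.2] /\
            [/\ ell kl.1 = ell nu, (ell nu <= ell mu)%N, ell mu = ell kl.2
              & vertical_strip kl.2 mu]].

Lemma finite_spart_bounded (B : nat) :
  finite_set [set nu : spart | forall i, (part nu i <= B)%N].
Proof.
pose f (nu : spart) : {fset nat} := [fset x in parts nu].
pose K : {fset nat} := [fset x in iota 0 (B + 1)].
have fin : finite_set (f @^-1` [set` fpowerset K]).
  apply: finite_preimage; last exact: finite_fset.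
  move=> x y _ _ /fsetP exy; apply: val_inj => /=.
  have st (z : spart) : sorted gtn z by case: z => s /= /andP[].
  apply: (irr_sorted_eq (leT := gtn)) => //.
  - by move=> a b c /= h1 h2; exact: ltn_trans h2 h1.
  - by move=> a; rewrite /= ltnn.
  - by move=> a; have := exy a; rewrite !inE.
apply: sub_finite_set fin => nu /= hB.
rewrite fpowersetE; apply/fsubsetP => x; rewrite !inE mem_iota add0n addn1 ltnS /=.
by move=> /(nthP 0%N)[k _ <-]; exact: (hB k.+1).
Qed.

Lemma part_le_sumn (mu : spart) (i : nat) : (part mu i <= sumn mu)%N.
Proof.
rewrite /part; elim: (parts mu) i.-1 => [|x s IH] [|k] //=.
  exact: leq_addr.
exact: leq_trans (IH k) (leq_addl _ _).
Qed.

Lemma finite_spsub (mu : spart) : finite_set [set nu | spsub nu mu].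
Proof.
apply: sub_finite_set (finite_spart_bounded (sumn mu)) => nu /= h i.
have := leq_trans (h i.-1.+1 isT) (part_le_sumn mu i.-1.+1).
by rewrite /part.
Qed.

Lemma finite_rem_sub (mu : spart) : finite_set (rem_sub mu).
Proof. by apply: sub_finite_set (finite_spsub mu) => nu []. Qed.

Lemma finite_expansion_pairs (mu nu : spart) :
  finite_set (expansion_pairs mu nu).
Proof.
apply: sub_finite_set
  (finite_setX (finite_spsub nu) (finite_spart_bounded (sumn mu).+1)).
move=> [k l] [[/= hk _ _] [_ _ _ vs]]; split=> //= i.
have : (part l i.-1.+1 <= (part mu i.-1.+1).+1)%N.
  rewrite leqNgt; apply/negP; set j := i.-1.+1 => hj.
  have inl (d : nat) : (d < 2)%N -> (j, j + part mu j + d)%N \in skewSD l mu.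
    move=> d2; rewrite inE !in_SD /= -!addnA !leq_addr !ltn_add2l.
    rewrite ltnNge leq_addr /=.
    by apply: leq_trans hj; rewrite -addnS -[X in (_ <= X)%N]addn2 leq_add2l.
  have := vs _ _ (inl 0%N isT) (inl 1%N isT) erefl.
  by case=> /eqP; rewrite eqn_add2l.
by move=> h; apply: leq_trans h _; rewrite ltnS part_le_sumn.
Qed.

Lemma finite_tableaux (lam mu : spart) (m : monom) :
  finite_set [set T | SetShYT_Q lam mu T /\ has_monom T m].
Proof.
pose f (T : filling) : {fset (nat * nat) * nat} :=
  [fset p in [seq (b, a) | b <- finsupp T, a <- T b]].
have fE T b a : ((b, a) \in f T) = (a \in T b).
  rewrite !inE; apply/allpairsPdep/idP => [[c [d [_ hd [-> ->]]]] //|hab].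
  exists b, a; split=> //; rewrite mem_finsupp; apply/eqP => h0.
  by rewrite h0 in hab.
pose N := (\max_(i <- finsupp m) i).*2.+1.
pose K : {fset (nat * nat) * nat} :=
  [fset p in [seq (b, a) | b <- skewSD lam mu, a <- iota 0 N]].
have fin : finite_set (f @^-1` [set` fpowerset K]).
  apply: finite_preimage; last exact: finite_fset.
  move=> x y _ _ /fsetP exy; apply/fsfunP => b; apply/fsetP => a.
  by rewrite -!fE exy.
apply: sub_finite_set fin => T /= [[sT _ _ _ _] hm].
rewrite fpowersetE; apply/fsubsetP => -[b a]; rewrite fE => hab.
have bT : b \in finsupp T.
  by rewrite mem_finsupp; apply/eqP => h0; rewrite h0 in hab.
rewrite !inE; apply/allpairsPdep; exists b, a; rewrite -sT bT; split=> //.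
rewrite mem_iota /= ltnS.
have ia : letter_index a \in finsupp m.
  rewrite mem_finsupp hm /tab_mult (big_fsetD1 b) //= addn_eq0 negb_and.
  by rewrite cardfs_eq0; apply/orP; left; apply/fset0Pn; exists a; rewrite !inE hab /=.
have h : (letter_index a <= \max_(i <- finsupp m) i)%N.
  by rewrite (big_fsetD1 (letter_index a)) //= leq_maxl.
apply: leq_trans (_ : (letter_index a).*2 <= _)%N; last by rewrite leq_double.
by rewrite -leq_uphalf_double.
Qed.

Lemma fps_scaleE (c : {poly rat}) (F : fps) (m : monom) :
  (c *: F) m = c * F m.
Proof. by []. Qed.

(* Main.v *)
Require Import Defs.
From mathcomp Require Import all_boot all_order all_algebra.
From mathcomp Require Import finmap.
From mathcomp Require Import boolp classical_sets functions cardinality fsbigop.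
From mathcomp Require Import zify ring.

(** Index matrices by strict partitions. Let [F_Q] and [F_P] be the matrices with entries
    [GQ_{mu//nu}] and [GP_{mu//nu}], let [A(mu, lam) = 2^l(mu) (-1)^cols(lam/mu)
    (-beta/2)^|lam/mu|] when [lam/mu] is a vertical strip with [l(lam) = l(mu)], and let
    [B(kap, nu) = 2^(overlap(nu/kap) - l(nu)) (-beta/2)^|nu/kap|] when [l(kap) = l(nu)]; other
    entries are zero. The theorem reads [F_Q = A F_P B].

    Removing the largest letter from a tableau of "//" shape factors [F_Q] and [F_P] into
    one-letter matrices: [H_x] for an unprimed letter, and for a primed letter [V_x] in [F_Q] and
    [VP_x] in [F_P]. With [A'_x] equal to [A] except in the rows of a part 1, one has
    [A H_x = H_x A'_x], [V_x A = A'_x VP_x] and [A B = 1], hence [F_Q A = A F_P] and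
    [F_Q = F_Q A B = A F_P B].

    All these matrices are products of local row factors. In the sums over an intermediate
    partition each row has only two possible lengths, so the three identities follow by
    induction on the number of rows from a linear relation between two partial sums. *)

Set Implicit Arguments.
Unset Strict Implicit.
Unset Printing Implicit Defensive.
Import GRing.Theory.
Local Open Scope classical_set_scope.
Local Open Scope fset_scope.
Local Open Scope ring_scope.

(** * Row weights and two-state row recursions *)

(** Peeling closes up for the double-slash shapes because a box of the smaller shape that holds the
    largest letter beside smaller ones is necessarily removable in that shape. The matrix [A'] is
    forced by the diagonal. A primed letter may delete a diagonal box in [V] but not in [VP], so
    [A'] itself must delete a part 1, with weight [x]. When the part 1 stays, [V A] gives
    [2 (1 + b x)], of which [A' VP] obtains [b x] through a lengthened row, and [2 + b x] remains.
    The sign in [A] and the factors [1 + b x] depend on whether consecutive rows end in the same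
    column, so neighbouring rows are coupled and the sums do not split row by row; the linear
    relation carried along compensates for this coupling. The space [fps] is only a module, so the
    matrices live over a polynomial ring instead: a fixed monomial involves finitely many letters,
    and substituting powers of one variable reads off its coefficient. Indices range over a finite
    box of partitions; the letter matrices only shrink a partition and [A] lengthens a row by at
    most one, so one spare column suffices. *)

Definition strict0 (s s' : nat) : bool := (s' < s)%N || (s == 0%N) && (s' == 0%N).

(* Row factors of A, A', H, V and VP. The arguments are row lengths: rows i of mu and of lam
   and row i+1 of lam for the entry (mu, lam) of A and A'; rows i of lam and of mu and row i+1
   of lam (for H) or of mu (for V and VP) for the entry (lam, mu). *)
Section Weights.
Variables (R : comNzRingType) (b x : R).

Definition wA (a a1 d1 : nat) : R :=
  if ~~ strict0 a1 d1 then 0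
  else if a == 0%N then (if a1 == 0%N then 1 else 0)
  else if a1 == a then 2
  else if a1 == a.+1 then (if d1 == a then - b else b) else 0.

Definition wA' (a a1 d1 : nat) : R :=
  if (a == 1%N) && (d1 == 0%N) && (a1 == 0%N) then x
  else if (a == 1%N) && (d1 == 0%N) && (a1 == 1%N) then 2 + b * x
  else wA a a1 d1.

Definition wH (u a c : nat) : R :=
  if (a <= u)%N && ((c < a)%N || (c == 0%N))
  then x ^+ (u - a) *
       (if (a == 0%N) || (a == c.+1) && (c != 0%N) then 1 else 1 + b * x)
  else 0.

Definition wV (u a d : nat) : R :=
  if ~~ strict0 a d then 0
  else if u == a then (if (a == 1%N) || (d.+1 < a)%N then 1 + b * x else 1)
  else if u == a.+1 then x else 0.

Definition wVP (u a d : nat) : R :=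
  if ~~ strict0 a d then 0
  else if u == a then (if (d.+1 < a)%N then 1 + b * x else 1)
  else if (u == a.+1) && (a != 0%N) then x else 0.

End Weights.

Section Transfer.
Variables (R : comNzRingType) (B : nat).
Implicit Types (w : nat -> nat -> nat -> R) (n s : nat).

(** Unrolled, a transfer-matrix sum over row sequences that start at [s]; the base case forces row
    [n] to be empty. *)
Fixpoint transfer n w s : R :=
  if n is n'.+1
  then \sum_(s' < B.+1) w 0%N s s' * transfer n' (fun i => w i.+1) s'
  else (s == 0%N)%:R.

Lemma sum_two_states (F : nat -> R) (a : nat) : (a < B)%N ->
  (forall s, s != a -> s != a.+1 -> F s = 0) ->
  \sum_(s < B.+1) F s = F a + F a.+1.
Proof.
move=> aB F0; have a1 : (a.+1 < B.+1)%N by [].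
have a0 : (a < B.+1)%N by exact: ltnW.
rewrite (bigD1 (Ordinal a0)) //= (bigD1 (Ordinal a1)) /=; last first.
  by rewrite -val_eqE /= gtn_eqF.
by rewrite big1 ?addr0 // => i /andP[]; rewrite -!val_eqE /= => h1 h2; exact: F0.
Qed.

End Transfer.

Ltac split_ifs :=
  repeat match goal with
  | |- context [if ?c then _ else _] =>
      let E := fresh "E" in case E: c; rewrite ?E /=; try (exfalso; lia)
  end.

(** Lets [ring] finish a goal modulo one known relation [p = q], used with multiplier [c]. *)
Lemma lin_comb (R : nzRingType) (c p q l r : R) :
  p = q -> l - r = c * (p - q) -> l = r.
Proof. by move=> ->; rewrite subrr mulr0 => /eqP; rewrite subr_eq0 => /eqP. Qed.

(** * The identity A H = H A' *)

Section Commute.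
Variables (R : comNzRingType) (b x : R) (B : nat).

(** For [p = 0] the two admissible rows are 0 and 1; the second is the part 1 that [A'] may
    delete. *)
Lemma AH_row_support u a p q s :
  s != p.-1 -> s != p.-1.+1 -> wH b x u s a * wA' b x s p q = 0.
Proof.
rewrite /wA' /wA /wH /strict0 => h1 h2; split_ifs; by rewrite ?mulr0 ?mul0r.
Qed.

(** [Z0] and [Z1] are the sums over the rows below, with next intermediate row [a] or [a.+1].
    Lengthening the present row from [u] to [u.+1] adds a factor [x] in [H] and trades 2 for [b] in
    [A], whence the relation between the new sums. The relation between the old sums turns the [H]
    factors, which depend on the intermediate row below, into a multiple of [Z0 + Z1]. *)
Lemma AH_step u a p q (Z0 Z1 : R) : strict0 u a -> strict0 p q ->
  (a = 0%N -> Z1 = 0) ->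
  ((0 < a)%N -> (q <= a)%N -> b * x * Z0 = 2 * Z1) ->
  ((a < q)%N -> Z0 = 0) ->
  ((a.+1 < q)%N -> Z1 = 0) ->
  let Z s := wA b u s a * wH b x s p a * Z0 + wA b u s a.+1 * wH b x s p a.+1 * Z1 in
  [/\ [/\ forall s, s != u -> s != u.+1 -> Z s = 0,
      Z u + Z u.+1 = (wH b x u p.-1 a * wA' b x p.-1 p q +
                       wH b x u p.-1.+1 a * wA' b x p.-1.+1 p q) * (Z0 + Z1),
      (u = 0%N -> Z u.+1 = 0)
     & ((0 < u)%N -> (p <= u)%N -> b * x * Z u = 2 * Z u.+1)],
      ((u < p)%N -> Z u = 0)
    & ((u.+1 < p)%N -> Z u.+1 = 0)].
Proof.
rewrite /strict0 => su sp h0 h1 h2 h3; split; first split.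
- move=> s n1 n2; rewrite /wA /wH /strict0; split_ifs; by rewrite ?(mulr0,mul0r,addr0).
- rewrite /wA' /wA /wH /strict0.
  case: p sp => [|p] sp /=.
    rewrite !subn0 subn1 /= exprS.
    have [a0|a0] := posnP a; first rewrite (h0 a0).
      case: u su => [|u] su /=; rewrite ?exprS; split_ifs; ring.
    split_ifs; ring.
  rewrite !subSS; have [pu|pu] := ltnP p u; last first.
    have [pu'|pu'] := eqVneq p u; last by split_ifs; rewrite ?(mul0r, mulr0, addr0).
    subst p; rewrite subnn expr0.
    have [qa|qa] := leqP q a; last first.
      rewrite (h2 qa); have [a0|a0] := posnP a; first by rewrite (h0 a0); split_ifs; ring.
      have [qa1|qa1] := ltnP a.+1 q; first by rewrite h3 //; split_ifs; ring.
      have qE : q = a.+1 by lia.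
      subst q; split_ifs; ring.
    have [a0|a0] := posnP a; first by rewrite (h0 a0); split_ifs; ring.
    have {}h1 := h1 a0 qa; split_ifs; try ring.
    by apply: (lin_comb (c := b) h1); ring.
  have -> : (u - p = (u - p.+1).+1)%N by lia.
  rewrite exprS; set X := x ^+ _.
  have [qa|qa] := leqP q a; last first.
    rewrite (h2 qa); have [a0|a0] := posnP a; first by rewrite (h0 a0); split_ifs; ring.
    have [qa1|qa1] := ltnP a.+1 q; first by rewrite h3 //; split_ifs; ring.
    have qE : q = a.+1 by lia.
    subst q; split_ifs; ring.
  have [a0|a0] := posnP a; first by rewrite (h0 a0); split_ifs; ring.
  have {}h1 := h1 a0 qa; split_ifs; try ring;
    by [apply: (lin_comb (c := X) h1); ring | apply: (lin_comb (c := b * x * X) h1); ring].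
- move=> u0; rewrite /wA /wH /strict0; split_ifs; by rewrite ?(mulr0,mul0r,addr0).
- move=> n1 n2; rewrite /wA /wH /strict0 subSn // exprS.
  have [a0|a0] := posnP a; first rewrite (h0 a0).
    split_ifs; ring.
  have [qa|qa] := leqP q a; last rewrite (h2 qa).
    split_ifs; ring.
  split_ifs; ring.
- by move=> n1; rewrite /wA /wH /strict0; split_ifs; rewrite ?(mulr0,mul0r,addr0).
- by move=> n1; rewrite /wA /wH /strict0; split_ifs; rewrite ?(mulr0,mul0r,addr0).
Qed.

Definition strictseq (m : nat -> nat) := forall i, strict0 (m i) (m i.+1).

Lemma transfer_AH n (m r : nat -> nat) :
  strictseq m -> strictseq r -> m n = 0%N -> r n = 0%N -> (m 0%N < B)%N ->
  let Z := transfer B n (fun i s s' => wA b (m i) s s' * wH b x s (r i) s') in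
  [/\ [/\ forall s, s != m 0%N -> s != (m 0%N).+1 -> Z s = 0,
      Z (m 0%N) + Z (m 0%N).+1 =
        \prod_(i < n) \sum_(s < B.+1) wH b x (m i) s (m i.+1) * wA' b x s (r i) (r i.+1),
      (m 0%N = 0%N -> Z (m 0%N).+1 = 0)
    & ((0 < m 0)%N -> (r 0 <= m 0)%N -> b * x * Z (m 0%N) = 2 * Z (m 0%N).+1)],
      ((m 0 < r 0)%N -> Z (m 0%N) = 0)
    & (((m 0).+1 < r 0)%N -> Z (m 0%N).+1 = 0)].
Proof.
elim: n m r => [|n IH] m r sm sr mn rn mB Z.
  rewrite /Z /= mn rn eqxx big_ord0 addr0; split=> //; split=> //.
  by move=> s /negbTE->.
have [] := IH (m \o succn) (r \o succn) (fun i => sm i.+1) (fun i => sr i.+1) mn rn.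
  by have := sm 0%N; rewrite /strict0 /=; lia.
set Z1 := transfer _ _ _ => /= -[supp1 sum1 zero1 rel1] lt1 lt2.
have ZE s : Z s = wA b (m 0%N) s (m 1%N) * wH b x s (r 0%N) (m 1%N) * Z1 (m 1%N) +
                  wA b (m 0%N) s (m 1%N).+1 * wH b x s (r 0%N) (m 1%N).+1 * Z1 (m 1%N).+1.
  apply: (sum_two_states (F := fun s' => _ s s' * Z1 s')).
    by have := sm 0%N; rewrite /strict0; lia.
  by move=> s' h1 h2; rewrite supp1 // mulr0.
rewrite !ZE big_ord_recl /= -sum1; clearbody Z1; clear IH sum1 supp1.
have -> : \sum_(s < B.+1) wH b x (m 0%N) s (m 1%N) * wA' b x s (r 0%N) (r 1%N)
  = wH b x (m 0%N) (r 0%N).-1 (m 1%N) * wA' b x (r 0%N).-1 (r 0%N) (r 1%N)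
    + wH b x (m 0%N) (r 0%N).-1.+1 (m 1%N) * wA' b x (r 0%N).-1.+1 (r 0%N) (r 1%N).
  have [pB|pB] := ltnP (r 0%N).-1 B.
    apply: (sum_two_states (F := fun s => wH b x _ s _ * wA' b x s _ _)) => // s.
    exact: AH_row_support.
  rewrite big1 => [|[s sB] _ /=]; rewrite /wA' /wA /wH; split_ifs;
    rewrite ?mulr0 ?mul0r ?addr0 //.
have [[supp sum zero rel] l1 l2] := AH_step (sm 0%N) (sr 0%N) zero1 rel1 lt1 lt2.
by split=> //; split=> // s h1 h2; rewrite ZE supp.
Qed.

End Commute.

(** * The identity V A = A' VP *)

Ltac split_inv :=
  split; [split| |split| ];
  try by (intros; try split; rewrite ?(mulr0, addr0); first [done | exfalso; lia]).

Section VA.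
Variables (R : comNzRingType) (b x : R) (B : nat).

(* u and p are the first rows of the outer partitions; L0 and L1 (R0 and R1) are the partial
   sums of V A (of A' VP) over the intermediate partitions with first row p and p-1 (p and p+1). *)
Definition VA_inv (u p : nat) (L0 L1 R0 R1 : R) : Prop :=
  [/\ [/\ L0 + L1 = R0 + R1,
          ((u == p) && (0 < p)%N -> 2 * (1 + b * x) * R1 = b * x * L0)
        & (p = 0%N -> L1 = 0 /\ R1 = 0)],
      ((u < p)%N -> L0 = 0 /\ R1 = 0),
      ((p < u)%N -> L1 = 0) /\ ((p < u)%N -> (0 < p)%N -> R0 = 0)
    & ([|| (p.+1 < u)%N, (u.+1 < p)%N | (u == 0%N) && (0 < p)%N] -> L0 + L1 = 0 /\ R0 = 0)].

(** The guarded equations of [VA_inv] solved in each relative position of [a] and [q], ready for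
    substitution. Only [VA_diag] retains a relation with non-constant coefficients. *)
Variant VA_spec (a q : nat) (L0 L1 R0 R1 : R) : Prop :=
| VA_zero of L0 = 0 & L1 = 0 & R0 = 0 & R1 = 0
| VA_empty of q = 0%N & (a <= 1)%N & L1 = 0 & R1 = 0 & L0 = R0
| VA_diag of a = q & (0 < q)%N & L1 = R0 + R1 - L0 & 2 * (1 + b * x) * R1 = b * x * L0
| VA_below of a.+1 = q & (0 < a)%N & L0 = 0 & R1 = 0 & L1 = R0
| VA_above of a = q.+1 & (0 < q)%N & L1 = 0 & R0 = 0 & L0 = R1.

Lemma VA_invP a q (L0 L1 R0 R1 : R) : VA_inv a q L0 L1 R0 R1 -> VA_spec a q L0 L1 R0 R1.
Proof.
move=> [[sumE relE zeroE] ltE [gtE gtE'] farE].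
have [fa|far] := boolP [|| (q.+1 < a)%N, (a.+1 < q)%N | (a == 0%N) && (0 < q)%N].
  have [l0 r0] := farE fa; apply: VA_zero => //.
  - have [h|h] := ltnP q a; first by move: l0; rewrite gtE // addr0.
    by have [] := ltE ltac:(lia).
  - have [h|h] := ltnP q a; first exact: gtE.
    by have [l0' _] := ltE ltac:(lia); move: l0; rewrite l0' add0r.
  by move: sumE; rewrite l0 r0 add0r.
have [q0|q0] := posnP q.
  have [l1 r1] := zeroE q0; apply: VA_empty => //; first by lia.
  by move: sumE; rewrite l1 r1 !addr0.
have [e|e] := eqVneq a q.
  apply: VA_diag => //; last by apply: relE; rewrite e eqxx.
  by rewrite -sumE addrC addKr.
have [lt|le] := ltnP a q.
  have [l0 r1] := ltE lt; apply: VA_below => //; try by lia.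
  by move: sumE; rewrite l0 r1 add0r addr0.
have lt : (q < a)%N by lia.
have r0 := gtE' lt q0; have l1 := gtE lt; apply: VA_above => //; first by lia.
by move: sumE; rewrite l1 r0 add0r addr0.
Qed.

Definition VA_L u p q (L0 L1 : R) s :=
  wV b x u s q * wA b s p q * L0 + wV b x u s q.-1 * wA b s p q * L1.
Definition VA_R u p q (R0 R1 : R) s :=
  wA' b x u s q * wVP b x s p q * R0 + wA' b x u s q.+1 * wVP b x s p q * R1.

Lemma wV_diag u d : (d < u)%N -> wV b x u u d = if (u == 1%N) || (d.+1 < u)%N then 1 + b * x else 1.
Proof. by move=> h; rewrite /wV /strict0 h eqxx. Qed.

Lemma wV_step u d : strict0 u d -> wV b x u.+1 u d = x.
Proof. by move=> h; rewrite /wV h (gtn_eqF (ltnSn u)) eqxx. Qed.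

Lemma wV_out u a d : u != a -> u != a.+1 -> wV b x u a d = 0.
Proof. by rewrite /wV => /negbTE-> /negbTE->; case: strict0. Qed.

Lemma wV_nonstrict u a d : ~~ strict0 a d -> wV b x u a d = 0.
Proof. by rewrite /wV => ->. Qed.

Lemma wA_nonstrict a s s' : ~~ strict0 s s' -> wA b a s s' = 0.
Proof. by rewrite /wA => ->. Qed.

Lemma wA_diag u d : (d < u)%N -> wA b u u d = 2.
Proof. by move=> h; rewrite /wA /strict0 h /= eqxx gtn_eqF // (leq_trans _ h). Qed.

Lemma wA_step u d : (0 < u)%N -> (d <= u)%N -> wA b u u.+1 d = if d == u then - b else b.
Proof. by move=> h1 h2; rewrite /wA /strict0 ltnS h2 /= gtn_eqF // (gtn_eqF (ltnSn u)) eqxx. Qed.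

Lemma wA_out u a d : u != a -> a != u.+1 -> wA b u a d = 0.
Proof.
rewrite /wA [u == a]eq_sym => /negbTE h1 /negbTE h2; rewrite h1 h2.
by case: strict0 => //=; case: eqP => // u0; rewrite -u0 h1.
Qed.

Lemma wA0 d : wA b 0 0 d = if d == 0%N then 1 else 0.
Proof. by rewrite /wA /strict0 /=; case: d. Qed.

Lemma wA0S a d : wA b 0 a.+1 d = 0.
Proof. by rewrite /wA; case: strict0. Qed.

Lemma wA'E u a d : (u != 1%N) || (a != 0%N) && (a != 1%N) -> wA' b x u a d = wA b u a d.
Proof. by rewrite /wA'; do 3!case: eqP => //=; rewrite ?andbF. Qed.

Lemma wA'11 d : wA' b x 1 1 d = if d == 0%N then 2 + b * x else 0.
Proof. by rewrite /wA' /wA /strict0; case: d. Qed.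

Lemma wVP_diag u d : (d < u)%N -> wVP b x u u d = if (d.+1 < u)%N then 1 + b * x else 1.
Proof. by move=> h; rewrite /wVP /strict0 h eqxx. Qed.

Lemma wVP_step u d : (d < u)%N -> wVP b x u.+1 u d = x.
Proof.
move=> h; rewrite /wVP /strict0 h /= (gtn_eqF (ltnSn u)) eqxx.
by case: u h.
Qed.

Lemma wVP_out u a d : u != a -> u != a.+1 -> wVP b x u a d = 0.
Proof. by rewrite /wVP => /negbTE-> /negbTE->; case: strict0. Qed.

Lemma wVP0 d : wVP b x 1 0 d = 0.
Proof. by rewrite /wVP /=; case: strict0. Qed.

Lemma wVP00 : wVP b x 0 0 0 = 1.
Proof. by []. Qed.

Section Rows.
Variables (L0 L1 R0 R1 : R).

Lemma VA_L_supp u p q s : s != p -> s != p.-1 -> VA_L u p q L0 L1 s = 0.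
Proof.
move=> h1 h2; rewrite /VA_L wA_out ?mulr0 ?mul0r ?addr0 //.
by apply: contra h2 => /eqP ->.
Qed.

Lemma VA_R_supp u p q s : s != p -> s != p.+1 -> VA_R u p q R0 R1 s = 0.
Proof. by move=> h1 h2; rewrite /VA_R wVP_out ?mulr0 ?mul0r ?addr0. Qed.

(** For [u = 1] the diagonal box is deleted by [V] on the left and, since [VP] cannot do it, by the
    entry [x] of [A'] on the right. *)
Lemma VA_step_empty u a : strict0 u a -> VA_spec a 0 L0 L1 R0 R1 ->
  VA_inv u 0 (VA_L u 0 0 L0 L1 0) 0 (VA_R u 0 0 R0 R1 0) (VA_R u 0 0 R0 R1 1).
Proof.
move=> su spec.
have r1 : VA_R u 0 0 R0 R1 1 = 0.
  have [->|u0] := eqVneq u 0%N; first by rewrite /VA_R !wA'E // !wA0S !mul0r addr0.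
  by rewrite /VA_R wVP0 !mulr0 !mul0r addr0.
have sum : VA_L u 0 0 L0 L1 0 = VA_R u 0 0 R0 R1 0.
  have e01 : (u <= 1)%N -> L0 + L1 = R0.
    move=> u1; have a0 : a = 0%N by move: su; rewrite /strict0; lia.
    case: spec => [-> -> -> _|_ _ -> _ ->|_ //|//|//]; by rewrite addr0.
  case: u su r1 e01 => [|[|u]] su r1 e01; rewrite /VA_L /VA_R.
  - by rewrite wA0 !wA'E // !wA0 wVP00 /= /wV /= -e01 //; ring.
  - by rewrite wA0 /= !wV_step // /wA' /= wVP00 wA_nonstrict // -e01 //; ring.
  by rewrite !wV_out // !mul0r.
have r0 : (1 < u)%N -> VA_R u 0 0 R0 R1 0 = 0.
  by move=> u1; rewrite /VA_R !wA'E ?wA_out ?mul0r ?addr0 //; lia.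
by rewrite r1 sum; split_inv; move=> far; rewrite r0 ?addr0 //; lia.
Qed.

Lemma VA_step_far u p q : (q < p)%N ->
  [|| (p.+1 < u)%N, (u.+1 < p)%N | (u == 0%N) && (0 < p)%N] ->
  VA_inv u p (VA_L u p q L0 L1 p) (VA_L u p q L0 L1 p.-1) (VA_R u p q R0 R1 p) (VA_R u p q R0 R1 p.+1).
Proof.
case: p => // p qp far; rewrite /=.
have l0 : VA_L u p.+1 q L0 L1 p.+1 = 0 by rewrite /VA_L !wV_out ?mul0r ?addr0 //; lia.
have l1 : VA_L u p.+1 q L0 L1 p = 0.
  have [p0|p0] := posnP p; first by rewrite p0 /VA_L wA0S !mulr0 !mul0r addr0.
  by rewrite /VA_L !wV_out ?mul0r ?addr0 //; lia.
have r0 : VA_R u p.+1 q R0 R1 p.+1 = 0.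
  have [->|u0] := posnP u; first by rewrite /VA_R !wA'E // !wA0S !mul0r addr0.
  by rewrite /VA_R !wA'E ?wA_out ?mul0r ?addr0 //; lia.
have r1 : VA_R u p.+1 q R0 R1 p.+2 = 0.
  have [->|u0] := posnP u; first by rewrite /VA_R !wA'E // !wA0S !mul0r addr0.
  by rewrite /VA_R !wA'E ?wA_out ?mul0r ?addr0 //; lia.
by rewrite l0 l1 r0 r1; split_inv.
Qed.

Lemma VA_step_above u p q : (q < p)%N -> u = p.+1 -> L0 + L1 = R0 + R1 ->
  VA_inv u p (VA_L u p q L0 L1 p) (VA_L u p q L0 L1 p.-1) (VA_R u p q R0 R1 p) (VA_R u p q R0 R1 p.+1).
Proof.
move=> qp -> sumE; case: p qp => // p qp; rewrite /=.
have l1 : VA_L p.+2 p.+1 q L0 L1 p = 0 by rewrite /VA_L !wV_out ?mul0r ?addr0 //; lia.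
have r0 : VA_R p.+2 p.+1 q R0 R1 p.+1 = 0.
  by rewrite /VA_R !wA'E // !wA_out ?mul0r ?addr0 //; lia.
have l0 : VA_L p.+2 p.+1 q L0 L1 p.+1 = 2 * x * (L0 + L1).
  by rewrite /VA_L !wV_step ?wA_diag ?/strict0 //; [ring|lia|lia].
have r1 : VA_R p.+2 p.+1 q R0 R1 p.+2 = 2 * x * (R0 + R1).
  by rewrite /VA_R !wA'E // !wA_diag ?wVP_step //; [ring|lia].
by rewrite l0 l1 r0 r1 sumE; split_inv; rewrite add0r addr0.
Qed.

(** While [q.+1 < p], both sides see the sums below only through their common total S: the new [L0]
    is [2 (1 + b x) S] and the new [R1] is [b x S], which is the relation. When [q.+1 = p > 1] the
    weights separate the two sums, and the relation of the row below enters. *)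
Lemma VA_step_diag a p q : strict0 p a -> (q < p)%N -> VA_spec a q L0 L1 R0 R1 ->
  VA_inv p p (VA_L p p q L0 L1 p) (VA_L p p q L0 L1 p.-1) (VA_R p p q R0 R1 p) (VA_R p p q R0 R1 p.+1).
Proof.
move=> sp qp spec; case: p sp qp => // p sp qp; rewrite /=.
suff [sum rel] : VA_L p.+1 p.+1 q L0 L1 p.+1 + VA_L p.+1 p.+1 q L0 L1 p =
    VA_R p.+1 p.+1 q R0 R1 p.+1 + VA_R p.+1 p.+1 q R0 R1 p.+2 /\
    2 * (1 + b * x) * VA_R p.+1 p.+1 q R0 R1 p.+2 = b * x * VA_L p.+1 p.+1 q L0 L1 p.+1.
  by split_inv.
rewrite /strict0 /= orbF ltnS in sp.
(* Row of length 1: its last box is diagonal, so [V] has [1 + b x] where [VP] has 1, and the entry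
   [2 + b x] of [A'] restores the balance. *)
have [p0|p0] := posnP p.
  have q0 : q = 0%N by lia.
  subst p q; rewrite /VA_L /VA_R /= wA0S wA'11 !wV_diag // !wA_diag // wVP_diag // wVP_step // wA'11 /=.
  rewrite !wA'E // !wA_step //=.
  by case: spec => [-> -> -> ->|_ _ -> -> ->|//|//|//]; split; ring.
have r1 : VA_R p.+1 p.+1 q R0 R1 p.+2 = b * x * (R0 + (if q == p then -1 else 1) * R1).
  rewrite /VA_R wVP_step // !wA'E ?orbT // !wA_step // ?(ltn_eqF qp) ?eqSS; last exact: ltnW.
  by case: (q == p); ring.
have [e|ne] := eqVneq q p.
  subst q; rewrite r1 eqxx /VA_L /VA_R.
  have -> : wV b x p.+1 p.+1 p = 1 by rewrite wV_diag // ltnn orbF eqSS (gtn_eqF p0).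
  have -> : wV b x p.+1 p.+1 p.-1 = 1 + b * x.
    by rewrite wV_diag ?ifT //; lia.
  have -> : wV b x p.+1 p p = 0 by rewrite wV_nonstrict // /strict0; lia.
  have -> : wV b x p.+1 p p.-1 = x by rewrite wV_step // /strict0; lia.
  have -> : wA b p.+1 p.+1 p = 2 by rewrite wA_diag.
  have -> : wA b p p.+1 p = - b by rewrite wA_step // eqxx.
  have -> : wA' b x p.+1 p.+1 p = 2 by rewrite wA'E ?wA_diag //; lia.
  have -> : wA' b x p.+1 p.+1 p.+1 = 0 by rewrite wA'E ?wA_nonstrict // ?/strict0; lia.
  have -> : wVP b x p.+1 p.+1 p = 1 by rewrite wVP_diag // ltnn.
  case: spec => [-> -> -> ->|q0|_ _ -> rel|_ _ -> -> ->|e _ _ _ _]; try by exfalso; lia.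
  - by split; ring.
  - by split; [apply: (lin_comb (c := 1) rel)|apply: (lin_comb (c := - (2 * b * x)) rel)]; ring.
  by split; ring.
have {}qp : (q < p)%N by lia.
have l0 : VA_L p.+1 p.+1 q L0 L1 p.+1 = 2 * (1 + b * x) * (L0 + L1).
  by rewrite /VA_L !wV_diag ?wA_diag ?ifT; try lia; ring.
have l1 : VA_L p.+1 p.+1 q L0 L1 p = x * b * (L0 + L1).
  rewrite /VA_L !wV_step ?wA_step ?/strict0; try lia.
  by rewrite (negbTE ne); ring.
have r0 : VA_R p.+1 p.+1 q R0 R1 p.+1 = 2 * (1 + b * x) * (R0 + R1).
  by rewrite /VA_R !wA'E ?wA_diag ?wVP_diag ?ifT; try lia; ring.
rewrite l0 l1 r0 r1 (negbTE ne).
have sumE : L0 + L1 = R0 + R1.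
  by case: spec => [-> -> -> ->|_ _ -> -> ->|_ _ -> _|_ _ -> -> ->|_ _ -> -> ->] //; ring.
by rewrite sumE; split; ring.
Qed.

Lemma VA_step_below u a p q : strict0 u a -> (0 < u)%N -> u.+1 = p -> (q < p)%N ->
  VA_spec a q L0 L1 R0 R1 ->
  VA_inv u p (VA_L u p q L0 L1 p) (VA_L u p q L0 L1 p.-1) (VA_R u p q R0 R1 p) (VA_R u p q R0 R1 p.+1).
Proof.
move=> su u0 <- qp spec; rewrite /=.
have l0 : VA_L u u.+1 q L0 L1 u.+1 = 0 by rewrite /VA_L !wV_out ?mul0r ?addr0 //; lia.
have r1 : VA_R u u.+1 q R0 R1 u.+2 = 0 by rewrite /VA_R !wA'E ?wA_out ?mul0r ?addr0 //; lia.
suff sum : VA_L u u.+1 q L0 L1 u = VA_R u u.+1 q R0 R1 u.+1.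
  by rewrite l0 r1 sum; split_inv; rewrite add0r addr0.
rewrite /strict0 (gtn_eqF u0) orbF in su.
have [e|ne] := eqVneq q u.
  subst q; rewrite /VA_L /VA_R wA_step // eqxx wV_nonstrict ?/strict0 ?ltnn ?(gtn_eqF u0) //.
  rewrite wV_diag ?prednK // ltnn orbF wVP_diag // ltnn !wA'E; try lia.
  rewrite wA_step // eqxx wA_nonstrict ?/strict0 ?ltnn //.
  case: spec => [-> -> -> ->|q0|e|e a0 -> -> ->|e]; try by exfalso; lia.
    by ring.
  by rewrite ifF; [ring|lia].
have {}qp : (q < u)%N by lia.
have sumE : L0 + L1 = R0 + R1.
  by case: spec => [-> -> -> ->|_ _ -> -> ->|_ _ -> _|_ _ -> -> ->|_ _ -> -> ->] //; ring.
have r0 : VA_R u u.+1 q R0 R1 u.+1 = b * (1 + b * x) * (R0 + (if q.+1 == u then -1 else 1) * R1).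
  rewrite /VA_R !wA'E ?wVP_diag ?wA_step; try lia.
  by rewrite ltnS qp (ltn_eqF qp); case: eqP => _; ring.
have l1 : VA_L u u.+1 q L0 L1 u =
    b * ((if (u == 1%N) || (q.+1 < u)%N then 1 + b * x else 1) * L0 + (1 + b * x) * L1).
  rewrite /VA_L !wV_diag ?wA_step; try lia.
  have -> : (u == 1%N) || (q.-1.+1 < u)%N by lia.
  by rewrite (ltn_eqF qp); ring.
rewrite l1 r0; have [e|ne1] := eqVneq q.+1 u; last first.
  by rewrite ifT; [rewrite -mulrDr sumE; ring|lia].
have -> : (u == 1%N) || (q.+1 < u)%N = (q == 0%N) by lia.
case: spec => [-> -> -> ->|-> _ -> -> ->|_ q0 -> rel|_ _ -> -> ->|e1 _ _ _ _]; last by exfalso; lia.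
- by case: ifP => _; ring.
- by rewrite eqxx; ring.
- by rewrite (gtn_eqF q0); apply: (lin_comb (c := b) rel); ring.
by case: ifP => _; ring.
Qed.

End Rows.

Lemma VA_step u a p q (L0 L1 R0 R1 : R) : strict0 u a -> strict0 p q ->
  VA_inv a q L0 L1 R0 R1 ->
  VA_inv u p (VA_L u p q L0 L1 p) (if p == 0%N then 0 else VA_L u p q L0 L1 p.-1)
    (VA_R u p q R0 R1 p) (VA_R u p q R0 R1 p.+1).
Proof.
move=> su sp inv; have spec := VA_invP inv.
have [p0|p0] := posnP p.
  have q0 : q = 0%N by move: sp; rewrite /strict0; lia.
  by subst p q; apply: VA_step_empty spec.
have qp : (q < p)%N by move: sp; rewrite /strict0; lia.
have [far|near] := boolP [|| (p.+1 < u)%N, (u.+1 < p)%N | (u == 0%N) && (0 < p)%N].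
  exact: VA_step_far far.
have [e|ne] := eqVneq u p; first by subst u; apply: VA_step_diag spec.
have [lt|gt] := ltnP u p; first by apply: (VA_step_below su) spec => //; lia.
by case: inv => [[sumE _ _] _ _ _]; apply: VA_step_above => //; lia.
Qed.

Lemma sum_two_states_down (F : nat -> R) (a : nat) : (a <= B)%N ->
  (forall s, s != a -> s != a.-1 -> F s = 0) ->
  \sum_(s < B.+1) F s = F a + (if a == 0%N then 0 else F a.-1).
Proof.
case: a => [|a] aB F0 /=; last by rewrite addrC; apply: sum_two_states => // s ? ?; apply: F0.
by rewrite big_ord_recl big1 ?addr0 // => i _; apply: F0.
Qed.

Lemma transfer_VA n (m r : nat -> nat) :
  strictseq m -> strictseq r -> m n = 0%N -> r n = 0%N -> (m 0%N < B)%N -> (r 0%N <= B)%N ->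
  let L := transfer B n (fun i s s' => wV b x (m i) s s' * wA b s (r i) (r i.+1)) in
  let R := transfer B n (fun i s s' => wA' b x (m i) s s' * wVP b x s (r i) (r i.+1)) in
  [/\ forall s, s != r 0%N -> s != (r 0%N).-1 -> L s = 0,
      forall s, s != r 0%N -> s != (r 0%N).+1 -> R s = 0
    & VA_inv (m 0%N) (r 0%N) (L (r 0%N)) (if r 0%N == 0%N then 0 else L (r 0%N).-1)
        (R (r 0%N)) (R (r 0%N).+1)].
Proof.
elim: n m r => [|n IH] m r sm sr mn rn mB rB L Rr.
  rewrite /L /Rr /= mn rn eqxx /=; split; try by move=> s /negbTE->.
  by split; [split| |split| ].
have m1B : (m 1%N < B)%N by have := sm 0%N; rewrite /strict0; lia.
have r1B : (r 1%N < B)%N by have := sr 0%N; rewrite /strict0; lia.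
have [] := IH (m \o succn) (r \o succn) (fun i => sm i.+1) (fun i => sr i.+1) mn rn m1B (ltnW r1B).
set L1 := transfer _ _ _; set R1 := transfer _ _ _ => /= suppL suppR inv.
have LE s : L s = wV b x (m 0%N) s (r 1%N) * wA b s (r 0%N) (r 1%N) * L1 (r 1%N) +
    wV b x (m 0%N) s (r 1%N).-1 * wA b s (r 0%N) (r 1%N) * (if r 1%N == 0%N then 0 else L1 (r 1%N).-1).
  rewrite /L /= (sum_two_states_down (F := fun s' => _ s s' * _ * L1 s') (a := r 1%N)) //.
  - by case: ifP => // _; rewrite mulr0.
  - exact: ltnW.
  - by move=> s' h1 h2; rewrite suppL // mulr0.
have RE s : Rr s = wA' b x (m 0%N) s (r 1%N) * wVP b x s (r 0%N) (r 1%N) * R1 (r 1%N) +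
    wA' b x (m 0%N) s (r 1%N).+1 * wVP b x s (r 0%N) (r 1%N) * R1 (r 1%N).+1.
  apply: (sum_two_states (F := fun s' => _ s s' * _ * R1 s')) => //.
  by move=> s' h1 h2; rewrite suppR // mulr0.
have inv' := VA_step (sm 0%N) (sr 0%N) inv.
split; [| |by rewrite !LE !RE] => s h1 h2; first by rewrite LE; apply: VA_L_supp.
by rewrite RE; apply: VA_R_supp.
Qed.

End VA.

(** * The identity A B = 1 *)

Section AB.
Variables (R : comNzRingType) (b c : R) (B : nat).
Hypothesis c2 : 2 * c = 1.

(* The truncated v1.+1 - k counts the columns shared by rows i and i+1 of nu/kap. *)
Definition wB (k v v1 : nat) : R :=
  if (k <= v)%N && ((k == 0%N) == (v == 0%N))
  then (if v == 0%N then 1 else c * (- (c * b)) ^+ (v - k) * 2 ^+ (v1.+1 - k)) else 0.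

(** [Z0] and [Z1] are the partial sums with intermediate row [u] and [u.+1], and [d] is the
    Kronecker delta of the remaining rows. For [u < p] the two sums need not vanish; they cancel. *)
Definition AB_inv (u p : nat) (Z0 Z1 d : R) : Prop :=
  [/\ Z0 + Z1 = d, (u = p \/ u = 0%N -> Z1 = 0), (p < u)%N -> Z0 = 0 /\ Z1 = 0
    & u <> p -> d = 0].

(** For [0 < u < p], passing from [u] to [u.+1] trades the 2 of [A] for [b] and removes one factor
    [- (c * b)] from [B]; since [2 * c = 1], the two contributions are opposite. *)
Lemma AB_step u a p q (Z0 Z1 d : R) : strict0 u a -> strict0 p q ->
  AB_inv a q Z0 Z1 d ->
  let Z s := wA b u s a * wB s p q * Z0 + wA b u s a.+1 * wB s p q * Z1 in
  (forall s, s != u -> s != u.+1 -> Z s = 0) /\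
  AB_inv u p (Z u) (Z u.+1) ((u == p)%:R * d).
Proof.
move=> su sp [sumE eqE ltE neE] Z; rewrite /strict0 in su sp.
have ZE s : Z s = wA b u s a * wB s p q * Z0 + wA b u s a.+1 * wB s p q * Z1 by [].
clearbody Z; split.
  by move=> s h1 h2; rewrite ZE /wA; split_ifs; rewrite ?(mulr0, mul0r, addr0).
have [lt|gt] := ltnP p u.
  have z0 : Z u = 0 by rewrite ZE /wB; split_ifs; rewrite ?(mulr0, mul0r, addr0).
  have z1 : Z u.+1 = 0 by rewrite ZE /wA /wB /strict0; split_ifs; rewrite ?(mulr0, mul0r, addr0).
  by rewrite gtn_eqF // z0 z1; split; rewrite ?(addr0, mul0r).
have [u0|u0] := posnP u.
  have a0 : a = 0%N by lia.
  have Z10 : Z1 = 0 by apply: eqE; right.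
  have z1 : Z u.+1 = 0 by rewrite ZE /wA /wB /strict0; split_ifs; rewrite ?(mulr0, mul0r, addr0).
  have z0 : Z u = (u == p)%:R * d.
    rewrite ZE Z10 -sumE Z10 u0.
    case: (p) => [|k]; rewrite /wA /wB /strict0 /=; split_ifs; ring.
  split=> //; first by rewrite z0 z1 addr0.
    by lia.
  by move/eqP/negbTE->; rewrite mul0r.
have [e|e] := eqVneq u p.
  subst p.
  have z1 : Z u.+1 = 0 by rewrite ZE /wA /wB /strict0; split_ifs; rewrite ?(mulr0, mul0r, addr0).
  have z0 : Z u = d.
    have [qa|qa] := ltnP q a.
      have [e0 e1] := ltE qa.
      by move: sumE; rewrite ZE e0 e1 !mulr0 addr0.
    have [e|e] := eqVneq a q.
      have Z10 : Z1 = 0 by apply: eqE; left.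
      move: sumE; rewrite ZE Z10 mulr0 !addr0 => ->.
      rewrite /wA /wB /strict0 subnn; split_ifs; try ring.
      have -> : (q.+1 - u = 0)%N by lia.
      by apply: (lin_comb (c := d) c2); ring.
    rewrite neE in sumE; last by apply/eqP.
    have Z1E : Z1 = - Z0 by apply/eqP; rewrite -addr_eq0 addrC sumE.
    rewrite ZE Z1E neE; last by apply/eqP.
    rewrite /wA /wB /strict0 subnn; split_ifs; ring.
  by rewrite mul1r z0 z1; split=> //; [rewrite addr0| lia].
have upE : (p - u = (p - u.+1).+1)%N by lia.
have z0 : Z u + Z u.+1 = 0.
  have [qa|qa] := ltnP q a.
    by have [e0 e1] := ltE qa; rewrite !ZE e0 e1 !mulr0 !addr0.
  have [eq|ne] := eqVneq a q.
    have Z10 : Z1 = 0 by apply: eqE; left.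
    rewrite !ZE Z10 !mulr0 !addr0 /wA /wB /strict0 upE exprS; set X := _ ^+ (p - _).
    split_ifs; try ring.
    have -> : (q.+1 - u = 0)%N by lia.
    have -> : (q.+1 - u.+1 = 0)%N by lia.
    by apply: (lin_comb (c := - (c * b * X * Z0)) c2); ring.
  rewrite neE in sumE; last by apply/eqP.
  have Z1E : Z1 = - Z0 by apply/eqP; rewrite -addr_eq0 addrC sumE.
  rewrite !ZE Z1E /wA /wB /strict0 upE exprS; set X := _ ^+ (p - _).
  split_ifs; try ring.
  (* Here [u = a.+1] and [Z1 = - Z0]. The sign [- b] in [A] doubles the sum at [u.+1], and one more
     overlapping column in [B] doubles the sum at [u], so they still cancel. *)
  have -> : (q.+1 - u = (q.+1 - u.+1).+1)%N by lia.
  rewrite exprS; set Y := _ ^+ (q.+1 - _).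
  by apply: (lin_comb (c := - (2 * c * b * X * Y * Z0)) c2); ring.
by split=> //; rewrite ?mul0r //; [case; lia| lia].
Qed.

Lemma transfer_AB n (m r : nat -> nat) :
  strictseq m -> strictseq r -> m n = 0%N -> r n = 0%N -> (m 0%N < B)%N ->
  let Z := transfer B n (fun i s s' => wA b (m i) s s' * wB s (r i) (r i.+1)) in
  (forall s, s != m 0%N -> s != (m 0%N).+1 -> Z s = 0) /\
  AB_inv (m 0%N) (r 0%N) (Z (m 0%N)) (Z (m 0%N).+1) (\prod_(i < n) (m i == r i)%:R).
Proof.
elim: n m r => [|n IH] m r sm sr mn rn mB Z.
  rewrite /Z /= mn rn eqxx big_ord0; split; first by move=> s /negbTE->.
  by split; rewrite ?addr0.
have m1B : (m 1%N < B)%N by have := sm 0%N; rewrite /strict0; lia.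
have [] := IH (m \o succn) (r \o succn) (fun i => sm i.+1) (fun i => sr i.+1) mn rn m1B.
set Z1 := transfer _ _ _ => /= supp inv.
have ZE s : Z s = wA b (m 0%N) s (m 1%N) * wB s (r 0%N) (r 1%N) * Z1 (m 1%N) +
    wA b (m 0%N) s (m 1%N).+1 * wB s (r 0%N) (r 1%N) * Z1 (m 1%N).+1.
  apply: (sum_two_states (F := fun s' => _ s s' * _ * Z1 s')) => //.
  by move=> s' h1 h2; rewrite supp // mulr0.
have [sZ inv'] := AB_step (sm 0%N) (sr 0%N) inv.
by rewrite !ZE big_ord_recl; split=> // s h1 h2; rewrite ZE sZ.
Qed.

End AB.

(** * Sums over strict partitions *)

(** Zero-based counterpart of [part]: [row lam i] is the length of diagram row [i.+1]. *)
Definition row (lam : spart) (i : nat) : nat := nth 0%N lam i.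

Lemma strict_row (lam : spart) : strictseq (row lam).
Proof.
case: lam => s; rewrite /is_strict_part /row /= => /andP[so s0] i; rewrite /strict0.
have [si|si] := ltnP i.+1 (size s); last first.
  by rewrite [nth _ _ i.+1]nth_default // andbT; case: (nth _ _ _).
have /(sortedP 0%N)/(_ i si) := so.
by rewrite /= => ->.
Qed.

Lemma row_gt0 (lam : spart) i : (0 < row lam i)%N = (i < ell lam)%N.
Proof.
case: lam => s; rewrite /is_strict_part /row /ell /= => /andP[so s0].
have [si|si] := ltnP i (size s); last by rewrite nth_default.
by rewrite lt0n; apply: contra s0 => /eqP<-; apply: mem_nth.
Qed.

Lemma row_eq0 (lam : spart) i : (ell lam <= i)%N -> row lam i = 0%N.
Proof. by rewrite leqNgt -row_gt0 lt0n negbK => /eqP. Qed.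

Lemma row_inj (lam mu : spart) : row lam =1 row mu -> lam = mu.
Proof.
move=> e; apply: val_inj; apply: (@eq_from_nth _ 0%N) => [|i _]; last exact: e.
by apply/eqP; rewrite eqn_leq; apply/andP; split; rewrite leqNgt -[X in ~~ X]row_gt0;
  [rewrite -/(ell lam) e|rewrite -/(ell mu) -e]; rewrite row_gt0 ltnn.
Qed.

Lemma strictseq_antitone (m : nat -> nat) i j : strictseq m -> (i <= j)%N -> (m j <= m i)%N.
Proof.
move=> sm; elim: j => [|j IH]; first by rewrite leqn0 => /eqP->.
rewrite leq_eqVlt => /predU1P[->//|]; rewrite ltnS => /IH.
by have := sm j; rewrite /strict0; lia.
Qed.

Fixpoint srows (t : seq nat) : bool :=
  if t is s :: t' then strict0 s (head 0%N t') && srows t' else true.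

Lemma srowsP (t : seq nat) : srows t <-> strictseq (nth 0%N t).
Proof.
elim: t => [|s t IH] /=; first by split=> // _ i; rewrite !nth_nil.
split=> [/andP[h /IH st] [|i]|st]; [by rewrite /= nth0|exact: st|].
by apply/andP; split; [have := st 0%N; rewrite /= nth0|apply/IH => i; exact: (st i.+1)].
Qed.

(** In a list satisfying [srows] the zeros form a tail, so filtering removes only padding. *)
Lemma srows_filter (t : seq nat) : srows t ->
  is_strict_part [seq s <- t | (0 < s)%N] /\
  forall i, nth 0%N [seq s <- t | (0 < s)%N] i = nth 0%N t i.
Proof.
elim: t => [|s t IH] //= /andP[h st].
have {IH} [st' nE] := IH st.
have hE : head 0%N [seq s <- t | (0 < s)%N] = head 0%N t by rewrite -!nth0 nE.
case: posnP => s0; last first.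
  split=> [|[|i]] //=.
  move: st'; rewrite /is_strict_part inE negb_or (ltn_eqF s0) /= => /andP[so n0].
  rewrite n0 andbT; move: hE so; case: [seq _ <- _ | _] => [|s1 t1] //= e so.
  by move: h; rewrite -e /strict0 (gtn_eqF s0) orbF => ->.
have t0 i : nth 0%N t i = 0%N.
  move/srowsP: st => st; have := strictseq_antitone (i := 0%N) (j := i) st isT.
  by rewrite nth0; move: h; rewrite s0 /strict0; lia.
by split=> // i; rewrite nE t0; case: i => [|i] //=; rewrite t0.
Qed.

Section RowLists.
Variables (B : nat).

Fixpoint rowlists (n : nat) : seq (seq nat) :=
  if n is n'.+1 then [seq s :: t | s <- iota 0 B.+1, t <- rowlists n'] else [:: [::]].

Lemma mem_rowlists n t : (t \in rowlists n) = (size t == n) && all (leq^~ B) t.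
Proof.
elim: n t => [|n IH] t; first by rewrite inE; case: t.
rewrite -[rowlists n.+1]/[seq s :: t | s <- iota 0 B.+1, t <- rowlists n].
apply/allpairsP/idP => [[[s t'] []]|].
  by rewrite mem_iota IH add0n ltnS => /= sB /andP[t'n t'B] ->; rewrite /= eqSS t'n sB.
case: t => [|s t] //; rewrite [size _]/= eqSS => /andP[st /andP[sB tB]].
by exists (s, t); rewrite mem_iota IH add0n ltnS; split=> //; apply/andP.
Qed.

Lemma uniq_rowlists n : uniq (rowlists n).
Proof.
elim: n => // n IH; apply: allpairs_uniq => //; first exact: iota_uniq.
by move=> [s t] [s' t'] _ _ /= [-> ->].
Qed.

Definition spart0 : spart := @SPart [::] isT.

(** The default [spart0] only makes the function total; [sparts] applies it to lists satisfying
    [srows]. *)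
Definition spart_of_rows (t : seq nat) : spart := insubd spart0 [seq s <- t | (0 < s)%N].

Lemma row_spart_of_rows t i : srows t -> row (spart_of_rows t) i = nth 0%N t i.
Proof.
by move=> /srows_filter[st nE]; rewrite /row /spart_of_rows /insubd insubT /= nE.
Qed.

Definition sparts (n : nat) : seq spart := [seq spart_of_rows t | t <- rowlists n & srows t].

Lemma mem_sparts n lam : (lam \in sparts n) = (row lam 0 <= B)%N && (ell lam <= n)%N.
Proof.
apply/mapP/idP => [[t] | /andP[lB ln]].
  rewrite mem_filter mem_rowlists => /andP[st /andP[/eqP tn tB]] ->.
  rewrite row_spart_of_rows //; apply/andP; split.
    by have [t0|t0] := posnP (size t); [rewrite nth_default ?t0|apply: (all_nthP 0%N tB)].
  by rewrite leqNgt -row_gt0 row_spart_of_rows // -tn nth_default.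
have nE i : nth 0%N (mkseq (row lam) n) i = row lam i.
  have [lt|ge] := ltnP i n; first by rewrite nth_mkseq.
  by rewrite nth_default ?size_mkseq // row_eq0 // (leq_trans ln).
have sr : srows (mkseq (row lam) n).
  by apply/srowsP => i; rewrite !nE; apply: strict_row.
exists (mkseq (row lam) n); last by apply: row_inj => i; rewrite row_spart_of_rows.
rewrite mem_filter sr mem_rowlists size_mkseq eqxx /=; apply/allP => s /(nthP 0%N)[i].
by rewrite size_mkseq => _ <-; rewrite nE (leq_trans _ lB) // strictseq_antitone //; apply: strict_row.
Qed.

Lemma uniq_sparts n : uniq (sparts n).
Proof.
rewrite map_inj_in_uniq ?filter_uniq ?uniq_rowlists // => t u.
rewrite !mem_filter !mem_rowlists => /andP[st /andP[/eqP tn _]] /andP[su /andP[/eqP un _]] e.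
apply: (@eq_from_nth _ 0%N) => [|i _]; first by rewrite tn un.
by rewrite -!row_spart_of_rows // e.
Qed.

Section Sums.
Variable R : comNzRingType.

(** Strictness is traded for the vanishing of the summand, so that the rows range independently and
    the sum becomes a transfer sum or a product. *)
Lemma sum_sparts n (F : (nat -> nat) -> R) :
  (forall f g, f =1 g -> F f = F g) ->
  (forall t, t \in rowlists n -> ~~ srows t -> F (nth 0%N t) = 0) ->
  \sum_(lam <- sparts n) F (row lam) = \sum_(t <- rowlists n) F (nth 0%N t).
Proof.
move=> Fext F0; rewrite big_map big_filter big_mkcond /= !big_seq; apply: eq_bigr => t tn.
case: ifPn => [st|/F0-> //]; by apply: Fext => i; rewrite row_spart_of_rows.
Qed.

Lemma sum_rowlists n (F : seq nat -> R) :
  \sum_(t <- rowlists n.+1) F t =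
  \sum_(s < B.+1) \sum_(t <- rowlists n) F ((s : nat) :: t).
Proof.
rewrite -[rowlists n.+1]/[seq s :: t | s <- iota 0 B.+1, t <- rowlists n].
rewrite big_allpairs_dep -(big_mkord xpredT (fun s => \sum_(t <- rowlists n) F (s :: t))).
by rewrite /index_iota subn0.
Qed.

Lemma sum_rowlists_transfer n (w : nat -> nat -> nat -> R) :
  \sum_(t <- rowlists n) \prod_(i < n) w i (nth 0%N t i) (nth 0%N t i.+1) =
  \sum_(s < B.+1) transfer B n w s.
Proof.
have key k (v : nat -> nat -> nat -> R) s : (s <= B)%N ->
    \sum_(t <- rowlists k | nth 0%N t 0 == s)
       \prod_(i < k) v i (nth 0%N t i) (nth 0%N t i.+1) = transfer B k v s.
  elim: k v s => [|k IH] v s sB.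
    by rewrite /= big_mkcond big_seq1 big_ord0 eq_sym; case: eqP.
  rewrite big_mkcond sum_rowlists /= (bigD1 (Ordinal (sB : s < B.+1)%N)) //=.
  rewrite [X in _ + X]big1 ?addr0 => [|j]; last first.
    by rewrite -val_eqE /= => /negbTE h; rewrite big1 // => t _; rewrite h.
  under eq_bigr => t _ do rewrite eqxx big_ord_recl /=.
  under [RHS]eq_bigr => s' _ do rewrite -IH ?(leq_ord s') // mulr_sumr big_mkcond /=.
  rewrite [RHS]exchange_big /= !big_seq; apply: eq_bigr => t tk.
  have tB : (nth 0%N t 0 < B.+1)%N.
    move: tk; rewrite mem_rowlists => /andP[_ tB].
    by have [t0|t0] := posnP (size t); [rewrite nth_default ?t0|apply: (all_nthP 0%N tB)].
  rewrite (bigD1 (Ordinal tB)) //= eqxx [X in _ + X]big1 ?addr0 // => j.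
  by rewrite -val_eqE /= eq_sym => /negbTE->.
under [RHS]eq_bigr => s _ do rewrite -key ?leq_ord // big_mkcond /=.
rewrite exchange_big /= !big_seq; apply: eq_bigr => t tk.
have tB : (nth 0%N t 0 < B.+1)%N.
  move: tk; rewrite mem_rowlists => /andP[_ tB].
  by have [t0|t0] := posnP (size t); [rewrite nth_default ?t0|apply: (all_nthP 0%N tB)].
rewrite (bigD1 (Ordinal tB)) //= eqxx [X in _ + X]big1 ?addr0 // => j.
by rewrite -val_eqE /= eq_sym => /negbTE->.
Qed.

Lemma sum_rowlists_prod n (f : nat -> nat -> R) :
  \sum_(t <- rowlists n) \prod_(i < n) f i (nth 0%N t i) =
  \prod_(i < n) \sum_(s < B.+1) f i s.
Proof.
elim: n f => [|n IH] f; first by rewrite big_seq1 !big_ord0.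
rewrite sum_rowlists big_ord_recl mulr_suml; apply: eq_bigr => s _.
by rewrite -(IH (fun i => f i.+1)) mulr_sumr; apply: eq_bigr => t _; rewrite big_ord_recl.
Qed.

Lemma prod_nonstrict n (w : nat -> nat -> nat -> R) (t : seq nat) : size t = n -> ~~ srows t ->
  (forall i s s', ~~ strict0 s s' -> w i s s' = 0) ->
  \prod_(i < n) w i (nth 0%N t i) (nth 0%N t i.+1) = 0.
Proof.
elim: t n w => [|s t IH] // [|n] w //= [tn] nst w0.
rewrite big_ord_recl /= nth0; move: nst; rewrite negb_and => /orP[/w0->|nst]; first by rewrite mul0r.
by rewrite (IH n (fun i => w i.+1)) ?mulr0 // => i; apply: w0.
Qed.

End Sums.
End RowLists.

(** * Row factors assembled into matrices indexed by strict partitions *)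

Section Matrices.
Variables (R : comNzRingType) (b : R) (n : nat).

Definition mxA (mu lam : spart) : R :=
  \prod_(i < n) wA b (row mu i) (row lam i) (row lam i.+1).
Definition mxA' (x : R) (mu lam : spart) : R :=
  \prod_(i < n) wA' b x (row mu i) (row lam i) (row lam i.+1).
Definition mxH (x : R) (lam mu : spart) : R :=
  \prod_(i < n) wH b x (row lam i) (row mu i) (row lam i.+1).
Definition mxV (x : R) (lam mu : spart) : R :=
  \prod_(i < n) wV b x (row lam i) (row mu i) (row mu i.+1).
Definition mxVP (x : R) (lam mu : spart) : R :=
  \prod_(i < n) wVP b x (row lam i) (row mu i) (row mu i.+1).
Definition mxB (c : R) (kap nu : spart) : R :=
  \prod_(i < n) wB b c (row kap i) (row nu i) (row nu i.+1).

Lemma sum_sparts_transfer B (w : nat -> nat -> nat -> R) :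
  (forall i s s', ~~ strict0 s s' -> w i s s' = 0) ->
  \sum_(lam <- sparts B n) \prod_(i < n) w i (row lam i) (row lam i.+1) =
  \sum_(s < B.+1) transfer B n w s.
Proof.
move=> w0; rewrite -sum_rowlists_transfer.
apply: (sum_sparts (F := fun f => \prod_(i < n) w i (f i) (f i.+1))).
  by move=> f g e; apply: eq_bigr => i _; rewrite !e.
by move=> t; rewrite mem_rowlists => /andP[/eqP tn _] nst; apply: prod_nonstrict.
Qed.

(** On the right each row of [sig] meets only fixed rows of [mu] and [rho], so the sum over [sig] is
    a product of one-row sums, which is the value found by [transfer_AH]. *)
Lemma mxAH B (x : R) (mu rho : spart) : (ell mu <= n)%N -> (ell rho <= n)%N -> (row mu 0 < B)%N ->
  \sum_(lam <- sparts B n) mxA mu lam * mxH x lam rho =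
  \sum_(sig <- sparts B n) mxH x mu sig * mxA' x sig rho.
Proof.
move=> mn rn mB.
have [[supp sumE _ _] _ _] := transfer_AH b x (strict_row mu) (strict_row rho)
  (row_eq0 mn) (row_eq0 rn) mB.
transitivity (\sum_(s < B.+1) transfer B n
    (fun i s s' => wA b (row mu i) s s' * wH b x s (row rho i) s') s).
  rewrite -sum_sparts_transfer; last by move=> i s s' h; rewrite wA_nonstrict ?mul0r.
  by apply: eq_bigr => lam _; rewrite -big_split.
rewrite (sum_two_states (F := transfer B n _) mB supp) sumE -(@sum_rowlists_prod B _ n
  (fun i s => wH b x (row mu i) s (row mu i.+1) * wA' b x s (row rho i) (row rho i.+1))).
symmetry; rewrite -(sum_sparts (F := fun f => \prod_(i < n) (wH b x (row mu i) (f i) (row mu i.+1)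
   * wA' b x (f i) (row rho i) (row rho i.+1)))).
- by apply: eq_bigr => lam _; rewrite -big_split.
- by move=> f g e; apply: eq_bigr => i _; rewrite !e.
(* A nonzero [H] factor forces the rows of [t] to interlace with those of [mu], and interlacing
   implies strictness. *)
move=> t; rewrite mem_rowlists => /andP[/eqP tn _] nst; apply/eqP; apply: contraNT nst => nz.
apply/srowsP => i.
have fac j : (j < n)%N ->
    (nth 0%N t j <= row mu j)%N && ((row mu j.+1 < nth 0%N t j)%N || (row mu j.+1 == 0%N)).
  move=> jn; move: nz; rewrite (bigD1 (Ordinal jn)) //= /wH.
  by case: ifP => //; rewrite !mul0r eqxx.
have [lt|ge] := ltnP i n; last by rewrite !nth_default ?tn // (leq_trans ge).
have t1 : (nth 0%N t i.+1 <= row mu i.+1)%N.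
  have [lt'|ge'] := ltnP i.+1 n; first by case/andP: (fac _ lt').
  by rewrite nth_default ?tn.
by have := fac _ lt; rewrite /strict0; lia.
Qed.

Lemma mxVA B (x : R) (mu rho : spart) : (ell mu <= n)%N -> (ell rho <= n)%N ->
  (row mu 0 < B)%N -> (row rho 0 <= B)%N ->
  \sum_(lam <- sparts B n) mxV x mu lam * mxA lam rho =
  \sum_(sig <- sparts B n) mxA' x mu sig * mxVP x sig rho.
Proof.
move=> mn rn mB rB.
have [suppL suppR [[sumE _ _] ltE _ _]] := transfer_VA b x (strict_row mu) (strict_row rho)
  (row_eq0 mn) (row_eq0 rn) mB rB.
transitivity (\sum_(s < B.+1) transfer B n
    (fun i s s' => wV b x (row mu i) s s' * wA b s (row rho i) (row rho i.+1)) s).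
  rewrite -sum_sparts_transfer; last by move=> i s s' h; rewrite /wV h mul0r.
  by apply: eq_bigr => lam _; rewrite -big_split.
transitivity (\sum_(s < B.+1) transfer B n
    (fun i s s' => wA' b x (row mu i) s s' * wVP b x s (row rho i) (row rho i.+1)) s); last first.
  rewrite -sum_sparts_transfer.
    by apply: eq_bigr => lam _; rewrite -big_split.
  move=> i s s' h; rewrite /wA' wA_nonstrict //.
  by rewrite /strict0 in h; split_ifs; rewrite ?mul0r.
rewrite (sum_two_states_down (F := transfer B n _) rB suppL) sumE.
have [r1B|r1B] := ltnP (row rho 0) B; first by rewrite (sum_two_states (F := transfer B n _) r1B suppR).
(* The state [B.+1] of the right-hand sum lies outside the range. The sum at [B] vanishes by the far
   clause and the one at [B.+1] by the clause for a shorter [mu]. *)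
have rE : row rho 0 = B by lia.
have [_ R0] := ltE (leq_trans mB r1B).
rewrite R0 addr0 big_ord_recr /= big1 ?add0r ?rE // => i _.
by apply: suppR; have := ltn_ord i; lia.
Qed.

Lemma mxAB B (c : R) (mu rho : spart) : 2 * c = 1 -> (ell mu <= n)%N -> (ell rho <= n)%N ->
  (row mu 0 < B)%N ->
  \sum_(lam <- sparts B n) mxA mu lam * mxB c lam rho = (mu == rho)%:R.
Proof.
move=> c2 mn rn mB.
have [supp [sumE _ _ _]] := transfer_AB b c2 (strict_row mu) (strict_row rho)
  (row_eq0 mn) (row_eq0 rn) mB.
transitivity (\sum_(s < B.+1) transfer B n
    (fun i s s' => wA b (row mu i) s s' * wB b c s (row rho i) (row rho i.+1)) s).
  rewrite -sum_sparts_transfer; last by move=> i s s' h; rewrite wA_nonstrict ?mul0r.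
  by apply: eq_bigr => lam _; rewrite -big_split.
rewrite (sum_two_states (F := transfer B n _) mB supp) sumE.
have [->|ne] := eqVneq mu rho; first by rewrite big1 // => i _; rewrite eqxx.
have [i /negbTE ni] : exists i : 'I_n, row mu i != row rho i.
  apply/existsP; apply: contraNT ne => /existsPn h; apply/eqP/row_inj => i.
  have [lt|ge] := ltnP i n; first by apply/eqP; have := h (Ordinal lt); rewrite negbK.
  by rewrite !row_eq0 // (leq_trans _ ge).
by rewrite (bigD1 i) //= ni mul0r.
Qed.

End Matrices.

(** * Shifted diagrams and peeling off the largest letter *)

Local Open Scope nat_scope.

Lemma mem_SD (lam : spart) i j :
  ((i.+1, j) \in SD lam) = (i < j) && (j < i.+1 + row lam i).
Proof. by rewrite in_SD. Qed.

Lemma mem_SD0 (lam : spart) j : ((0, j) \in SD lam) = false.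
Proof. by rewrite in_SD. Qed.

Lemma mem_SD_gt0 (lam : spart) i j : (i, j) \in SD lam -> 0 < i <= j.
Proof. by rewrite in_SD => /andP[-> /andP[]]. Qed.

Lemma row_strict (lam : spart) i : (row lam i.+1 < row lam i) || (row lam i == 0) && (row lam i.+1 == 0).
Proof. exact: strict_row. Qed.

Lemma row_diag (lam : spart) i k : 0 < row lam (i + k) -> row lam (i + k) + k <= row lam i.
Proof.
elim: k => [|k IH]; first by rewrite !addn0.
by have := row_strict lam (i + k); rewrite addnS; lia.
Qed.

Lemma SD_ideal (lam : spart) i j i' j' :
  (i, j) \in SD lam -> 0 < i' <= i -> i' <= j' <= j -> (i', j') \in SD lam.
Proof.
case: i => [|i]; first by rewrite mem_SD0.
case: i' => // i'; rewrite !mem_SD => /andP[h1 h2] /= h3 /andP[h4 h5].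
have /row_diag : 0 < row lam (i' + (i - i')) by rewrite subnKC //; lia.
by rewrite subnKC //; lia.
Qed.

(** Converse of [SD_ideal]: each row length is the position of the first missing box, and closure
    towards the upper left makes these lengths strictly decrease until they are zero. *)
Lemma spart_of_ideal (D : {fset nat * nat}) :
  (forall i j : nat, (i, j) \in D -> 0 < i <= j) ->
  (forall i j i' j' : nat, (i, j) \in D -> 0 < i' <= i -> i' <= j' <= j -> (i', j') \in D) ->
  exists lam, SD lam = D.
Proof.
move=> D0 Did; pose M := (\max_(b <- D) (b.1 + b.2)).+1.
have DM i j : (i, j) \in D -> i + j < M.
  by move=> ijD; rewrite ltnS (big_fsetD1 _ ijD) leq_maxl.
have ex i : exists k, (i.+1, i.+1 + k) \notin D.
  by exists M; apply/negP => /DM; lia.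
pose c i := ex_minn (ex i).
have cE i j : ((i.+1, j) \in D) = (i < j) && (j < i.+1 + c i).
  apply/idP/idP => [ijD|/andP[ij jc]].
    have /andP[_ ij] := D0 _ _ ijD; rewrite ij /c; case: ex_minnP => k nk _.
    rewrite ltnNge; apply: contra nk => kj; by apply: Did ijD _ _; lia.
  move: jc; rewrite /c; case: ex_minnP => k nk kmin jk; apply/negPn/negP => nj.
  by have := kmin (j - i.+1); rewrite subnKC // nj => /(_ isT); lia.
have sc : strictseq c.
  move=> i; rewrite /strict0.
  have [ci|ci] := posnP (c i).
    rewrite ci /= -leqn0 leqNgt; apply/negP => c1.
    have : (i.+2, i.+2) \in D by rewrite cE; lia.
    by move/Did => /(_ i.+1 i.+1); rewrite cE ci; lia.
  rewrite /= orbF ltnNge; apply/negP => h.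
  have : (i.+2, i.+1 + c i) \in D by rewrite cE; lia.
  by move/Did => /(_ i.+1 (i.+1 + c i)); rewrite cE; lia.
have nE i : nth 0 (mkseq c M) i = c i.
  have [lt|ge] := ltnP i M; first by rewrite nth_mkseq.
  rewrite nth_default ?size_mkseq //; apply/esym/eqP; rewrite -leqn0 leqNgt.
  apply/negP => ci; have /DM : (i.+1, i.+1) \in D by rewrite cE; lia.
  by lia.
have sr : srows (mkseq c M) by apply/srowsP => i; rewrite !nE.
exists (spart_of_rows (mkseq c M)); apply/fsetP => -[[|i] j].
  by rewrite in_SD /=; apply/esym/negbTE/negP => /D0.
by rewrite mem_SD row_spart_of_rows // nE cE.
Qed.

Lemma SD_inj (lam mu : spart) : SD lam = SD mu -> lam = mu.
Proof.
move=> e; apply: row_inj => i.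
have h j : (i < j) && (j < i.+1 + row lam i) = (i < j) && (j < i.+1 + row mu i).
  by rewrite -!mem_SD e.
by have := h (i.+1 + row lam i); have := h (i.+1 + row mu i); lia.
Qed.

(** Removability read off the right and lower neighbours, a form suited to arithmetic on row
    lengths; [removableP] gives the equivalence. *)
Definition maxbox (nu : spart) (i j : nat) : bool :=
  [&& (i, j) \in SD nu, (i, j.+1) \notin SD nu & (i.+1, j) \notin SD nu].

(* The tableaux of GP_{mu//nu} and GQ_{mu//nu}: every box of mu/nu is filled, and any
   removable boxes of nu may be filled as well. *)
Record gtab (P : bool) (K : nat) (mu nu : spart) (T : filling) : Prop := Gtab {
  gtab_sub : forall i, row nu i <= row mu i;
  gtab_supp : forall i j a, a \in T (i, j) -> (i, j) \in SD mu;
  gtab_full : forall i j, (i, j) \in SD mu -> (i, j) \notin SD nu -> exists a, a \in T (i, j);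
  gtab_max : forall i j a, a \in T (i, j) -> (i, j) \in SD nu -> maxbox nu i j;
  gtab_letter : forall i j a, a \in T (i, j) -> 0 < a <= K;
  gtab_row : forall i j j' a a', j < j' -> a \in T (i, j) -> a' \in T (i, j') ->
    a <= a' /\ (a = a' -> ~~ odd a);
  gtab_col : forall i i' j a a', i < i' -> a \in T (i, j) -> a' \in T (i', j) ->
    a <= a' /\ (a = a' -> odd a);
  gtab_diag : P -> forall j a, a \in T (j, j) -> ~~ odd a }.

(** * Adding and removing the largest letter *)

Section Strips.
Variable n : nat.
Implicit Types (e : {ffun 'I_n -> bool}).

Definition ffext e (i : nat) : bool := if insub i is Some o then e o else false.

Lemma ffext_ord e (o : 'I_n) : ffext e o = e o.
Proof. by rewrite /ffext valK. Qed.

(* The boxes receiving the next letter: row i of mu from the end of row i of lam on,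
   starting with the last box of that row when e i holds. *)
Definition strip (mu lam : spart) e : {fset nat * nat} :=
  [fset b in SD mu | b.1 + (row lam b.1.-1 - ffext e b.1.-1) <= b.2].

(** [K] is the letter added. The flag [e] reuses the last box of the row of [lam], which must have
    no box of [lam] below it. A primed letter occupies at most one box of the row, and not the
    diagonal one under [P]; for an unprimed letter the strip must start beyond the end of the next
    row of [mu], so that no column repeats. *)
Definition strip_row (P : bool) (K mi mi1 li li1 : nat) (e : bool) : bool :=
  [&& li <= mi, e ==> (0 < li) && ((li == 1) || (li1.+1 < li))
    & if odd K then (mi <= (li - e).+1) && (P ==> (mi == 0) || (0 < li - e))
      else (mi1 < li - e) || (mi1 == 0)].

Definition strip_ok P K (mu lam : spart) e : bool :=
  [forall i : 'I_n, strip_row P K (row mu i) (row mu i.+1) (row lam i) (row lam i.+1) (e i)].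

Lemma in_strip mu lam e (b : nat * nat) : (b \in strip mu lam e) =
  (b \in SD mu) && (b.1 + (row lam b.1.-1 - ffext e b.1.-1) <= b.2).
Proof. by rewrite 2!inE. Qed.

Lemma mem_strip mu lam e i j :
  ((i.+1, j) \in strip mu lam e) = (i.+1 + (row lam i - ffext e i) <= j < i.+1 + row mu i).
Proof. by rewrite in_strip mem_SD /=; lia. Qed.

Lemma mem_strip0 mu lam e j : ((0, j) \in strip mu lam e) = false.
Proof. by rewrite in_strip mem_SD0. Qed.

Lemma strip_okE P K mu lam e i : ell mu <= n -> ell lam <= n -> strip_ok P K mu lam e ->
  strip_row P K (row mu i) (row mu i.+1) (row lam i) (row lam i.+1) (ffext e i).
Proof.
move=> mn ln /forallP h; have [lt|ge] := ltnP i n.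
  by have := h (Ordinal lt); rewrite -(ffext_ord e).
rewrite !row_eq0 ?(leq_trans _ ge) ?(leq_trans _ (leqW ge)) // /ffext insubF ?ltnNge ?ge //.
by rewrite /strip_row /=; case: odd; rewrite ?implybT.
Qed.

Definition add_letter (K : nat) (S : {fset nat * nat}) (T : filling) : filling :=
  [fsfun b in finsupp T `|` S => if b \in S then K |` T b else T b].

Lemma mem_add_letter K S T b a :
  (a \in add_letter K S T b) = (a \in T b) || (b \in S) && (a == K).
Proof.
rewrite fsfun_fun !inE; case: (boolP (b \in S)) => bS.
  by rewrite orbT !inE orbC.
rewrite orbF; case: finsuppP => /= h; rewrite ?orbF //.
Qed.

Section Peel.
Variables (P : bool) (K : nat) (mu nu : spart).
Hypothesis mun : ell mu <= n.

Lemma gtab_extend lam e T : ell lam <= n -> strip_ok P K.+1 mu lam e ->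
  gtab P K lam nu T -> gtab P K.+1 mu nu (add_letter K.+1 (strip mu lam e) T).
Proof.
move=> ln ok [sub supp full maxb let_ row_ col diag].
have okr i := strip_okE i mun ln ok.
have lm i : row lam i <= row mu i by have /and3P[] := okr i.
have SDs i j : (i, j) \in SD lam -> (i, j) \in SD mu.
  by case: i => [|i]; rewrite ?mem_SD0 // !mem_SD; have := lm i; lia.
have SDn i j : (i, j) \in SD nu -> (i, j) \in SD lam.
  by case: i => [|i]; rewrite ?mem_SD0 // !mem_SD; have := sub i; lia.
have Smax i j : (i, j) \in strip mu lam e -> (i, j) \in SD lam -> maxbox lam i j.
  case: i => [|i]; rewrite ?mem_strip0 // /maxbox => h1 h2; rewrite h2 /=.
  move: h1 h2; rewrite mem_strip !mem_SD.
  by have := okr i; rewrite /strip_row; case: (ffext e i) => /=; lia.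
split.
- by move=> i; apply: leq_trans (sub i) (lm i).
- move=> i j a; rewrite mem_add_letter => /orP[/supp/SDs//|/andP[]].
  by rewrite in_strip => /andP[].
- move=> i j h1 h2; case: (boolP ((i, j) \in SD lam)) => h3.
    by have [a aT] := full _ _ h3 h2; exists a; rewrite mem_add_letter aT.
  exists K.+1; rewrite mem_add_letter eqxx andbT orbC.
  case: i h1 h2 h3 => [|i]; first by rewrite mem_SD0.
  by rewrite mem_strip !mem_SD; lia.
- move=> i j a; rewrite mem_add_letter => /orP[/maxb//|/andP[h1 _] h2].
  have := Smax _ _ h1 (SDn _ _ h2); rewrite /maxbox h2 => /and3P[_ h3 h4] /=.
  by apply/andP; split; [apply: contra h3|apply: contra h4]; apply: SDn.
- move=> i j a; rewrite mem_add_letter => /orP[/let_|/andP[_ /eqP->]]; last by rewrite ltnS leqnn.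
  by lia.
- move=> i j j' a a' jj'; rewrite !mem_add_letter.
  move=> /orP[aT|/andP[aS /eqP->]] /orP[aT'|/andP[aS' /eqP->]].
  + exact: row_ aT aT'.
  + by have := let_ _ _ _ aT; lia.
  + have := supp _ _ _ aT'; case: i aS aT' => [|i]; first by rewrite mem_strip0.
    by rewrite mem_strip mem_SD; case: (ffext e i); lia.
  + split=> // _; case: i aS aS' => [|i]; first by rewrite mem_strip0.
    by rewrite !mem_strip; have := okr i; rewrite /strip_row; case: ifP => //; lia.
- move=> i i' j a a' ii'; rewrite !mem_add_letter.
  move=> /orP[aT|/andP[aS /eqP->]] /orP[aT'|/andP[aS' /eqP->]].
  + exact: col aT aT'.
  + by have := let_ _ _ _ aT; lia.
  + have := supp _ _ _ aT'; case: i ii' aS => [|i] ii' aS; first by rewrite mem_strip0 in aS.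
    move: (aS); rewrite mem_strip => h1 h2.
    have h3 : (i.+2, j) \in SD lam by apply: (SD_ideal h2); have := mem_SD_gt0 h2; lia.
    move: h3; rewrite mem_SD; have := okr i; rewrite /strip_row; have := row_strict lam i.
    by case: (ffext e i) h1; lia.
  + split=> // _; case: i ii' aS => [|i] ii' aS; first by rewrite mem_strip0 in aS.
    have h2 : (i', j) \in SD mu by move: aS'; rewrite in_strip => /andP[].
    have h3 : (i.+2, j) \in SD mu by apply: (SD_ideal h2); have := mem_SD_gt0 h2; lia.
    move: aS h3; rewrite mem_strip mem_SD; have := okr i; rewrite /strip_row.
    by case: ifP => // _; lia.
- move=> hP j a; rewrite mem_add_letter => /orP[/(diag hP)//|/andP[aS /eqP->]].
  case: j aS => [|j]; first by rewrite mem_strip0.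
  rewrite mem_strip; have := okr j; rewrite /strip_row hP; case: ifP => // _; lia.
Qed.

End Peel.
End Strips.

Definition del_letter (K : nat) (T : filling) : filling :=
  [fsfun b in finsupp T => T b `\ K].

Lemma mem_del_letter K (T : filling) b a :
  (a \in del_letter K T b) = (a != K) && (a \in T b).
Proof.
rewrite fsfun_fun; case: finsuppP => h; first by rewrite !inE andbF.
by rewrite in_fsetD1.
Qed.

Lemma mem_finsuppP (T : filling) b : reflect (exists a, a \in T b) (b \in finsupp T).
Proof. by rewrite mem_finsupp; apply: (iffP (fset0Pn _)). Qed.

Lemma filling_eq (T T' : filling) : (forall i j, T (i, j) =i T' (i, j)) -> T = T'.
Proof. by move=> h; apply/fsfunP => -[i j]; apply/fsetP/h. Qed.

Section Peel.
Variables (n : nat) (P : bool) (K : nat) (mu nu : spart).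
Hypothesis mun : ell mu <= n.

(** The shape [lam] consists of [nu] and the boxes holding a letter at most [K]. It is a diagram
    because a box to the upper left of such a box lies in [nu] or holds a letter at most [K]. Boxes
    of [lam] that also hold [K.+1] are maximal in [lam], hence ends of rows, and one flag per row
    records them. *)
Lemma gtab_peel T : gtab P K.+1 mu nu T ->
  exists lam e T', [/\ ell lam <= n, row lam 0 <= row mu 0, strip_ok P K.+1 mu lam e,
    gtab P K lam nu T' & T = add_letter K.+1 (strip (n := n) mu lam e) T'].
Proof.
move=> [sub supp full maxb let_ row_ col diag].
pose T' := del_letter K.+1 T.
have SDn i j : (i, j) \in SD nu -> (i, j) \in SD mu.
  by case: i => [|i]; rewrite ?mem_SD0 // !mem_SD; have := sub i; lia.
have memL i j : reflect ((i, j) \in SD nu \/ exists2 a, a \in T (i, j) & a <= K)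
                        ((i, j) \in SD nu `|` finsupp T').
  rewrite in_fsetU; apply: (iffP orP) => [[h|]|[h|[a aT aK]]]; [by left| | by left|].
    by move=> /mem_finsuppP[a]; rewrite mem_del_letter => /andP[a1 aT]; right; exists a => //;
      have := let_ _ _ _ aT; lia.
  by right; apply/mem_finsuppP; exists a; rewrite mem_del_letter aT andbT; lia.
have Lmu i j : (i, j) \in SD nu `|` finsupp T' -> (i, j) \in SD mu.
  by move=> /memL[/SDn//|[a /supp]].
have [lam lamE] : exists lam, SD lam = SD nu `|` finsupp T'.
  apply: spart_of_ideal => [i j /Lmu/mem_SD_gt0//|i j i' j' ijL hi hj].
  apply/memL; case: (boolP ((i', j') \in SD nu)) => nc; [by left|right].
  have [ijn|[a aT aK]] := memL _ _ ijL.
    by rewrite (SD_ideal ijn) in nc.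
  have ijm := Lmu _ _ ijL.
  have nm : (i', j) \notin SD nu.
    by apply: contra nc => h; apply: (SD_ideal h); lia.
  have [a2 aT2 a2a] : exists2 a2, a2 \in T (i', j) & a2 <= a.
    have [->|ne] := eqVneq i' i; first by exists a.
    have [a2 aT2] : exists a, a \in T (i', j).
      by apply: full nm; apply: (SD_ideal ijm); have := mem_SD_gt0 ijm; lia.
    have lt : i' < i by lia.
    by exists a2 => //; have [] := col _ _ _ _ _ lt aT2 aT.
  have [->|ne] := eqVneq j' j; first by exists a2 => //; apply: leq_trans a2a aK.
  have [a' aT'] := full _ _ (SD_ideal ijm hi hj) nc.
  have lt : j' < j by lia.
  by exists a' => //; have [h _] := row_ _ _ _ _ _ lt aT' aT2; lia.
have memlam i j : ((i, j) \in SD lam) -> (i, j) \in SD nu \/ exists2 a, a \in T (i, j) & a <= K.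
  by rewrite lamE => /memL.
have lammem i j a : a \in T (i, j) -> a <= K -> (i, j) \in SD lam.
  by move=> h1 h2; rewrite lamE; apply/memL; right; exists a.
have SDnl i j : (i, j) \in SD nu -> (i, j) \in SD lam by rewrite lamE in_fsetU => ->.
have SDlm i j : (i, j) \in SD lam -> (i, j) \in SD mu by rewrite lamE; apply: Lmu.
have lm i : row lam i <= row mu i.
  have [->//|l0] := posnP (row lam i).
  have : (i.+1, i + row lam i) \in SD mu by apply: SDlm; rewrite mem_SD; lia.
  by rewrite mem_SD; lia.
have nl i : row nu i <= row lam i.
  have [->//|l0] := posnP (row nu i).
  have : (i.+1, i + row nu i) \in SD lam by apply: SDnl; rewrite mem_SD; lia.
  by rewrite mem_SD; lia.
have ln : ell lam <= n.
  rewrite leqNgt -row_gt0 -leqNgt; apply: leq_trans (lm n) _.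
  by rewrite row_eq0.
have Smax i j : K.+1 \in T (i, j) -> (i, j) \in SD lam -> maxbox lam i j.
  move=> KT ijl; rewrite /maxbox ijl /=; apply/andP; split; apply/negP => h.
    have [hn|[a aT aK]] := memlam _ _ h.
      have ijn : (i, j) \in SD nu by apply: (SD_ideal hn); have := mem_SD_gt0 ijl; lia.
      by have := maxb _ _ _ KT ijn; rewrite /maxbox hn /= andbF.
    by have [] := row_ _ _ _ _ _ (ltnSn j) KT aT; lia.
  have [hn|[a aT aK]] := memlam _ _ h.
    have ijn : (i, j) \in SD nu by apply: (SD_ideal hn); have := mem_SD_gt0 ijl; lia.
    by have := maxb _ _ _ KT ijn; rewrite /maxbox hn /= !andbF.
  by have [] := col _ _ _ _ _ (ltnSn i) KT aT; lia.
pose e : {ffun 'I_n -> bool} :=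
  [ffun o : 'I_n => (0 < row lam o) && (K.+1 \in T ((o : nat).+1, o + row lam o))].
have eE i : ffext e i = (0 < row lam i) && (K.+1 \in T (i.+1, i + row lam i)).
  rewrite /ffext; case: insubP => [o _ <-|ni]; first by rewrite ffunE.
  by rewrite row_eq0 // (leq_trans ln) // leqNgt.
have SE i j : ((i, j) \in strip mu lam e) = (K.+1 \in T (i, j)).
  case: i => [|i].
    by rewrite mem_strip0; apply/esym/negbTE/negP => /supp; rewrite mem_SD0.
  rewrite mem_strip eE; apply/idP/idP => [h|KT].
    case: (boolP ((i.+1, j) \in SD lam)) => hl.
      move: h; case: (boolP (_ \in T _)) => KT; last by move: hl; rewrite mem_SD; lia.
      by move: hl; rewrite mem_SD => hl h; have -> : j = i + row lam i by lia.
    have hm : (i.+1, j) \in SD mu by move: hl; rewrite !mem_SD; lia.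
    have hn : (i.+1, j) \notin SD nu by apply: contra hl; apply: SDnl.
    have [a aT] := full _ _ hm hn.
    have aK := let_ _ _ _ aT; have [aK'|aK'] := leqP a K; last by have <- : a = K.+1 by lia.
    by rewrite (lammem _ _ _ aT aK') in hl.
  have := supp _ _ _ KT; rewrite mem_SD => hm.
  case: (boolP ((i.+1, j) \in SD lam)) => hl; last by move: hl; rewrite mem_SD; lia.
  have := Smax _ _ KT hl; rewrite /maxbox !mem_SD => hh.
  have jE : j = i + row lam i by move: hl; rewrite mem_SD; lia.
  by rewrite -jE KT; move: hl; rewrite mem_SD; lia.
exists lam, e, T'; split=> //.
- apply/forallP => o; rewrite -(ffext_ord e); move: (o : nat) => {o}i.
  have eM : ffext e i -> (0 < row lam i) && ((row lam i == 1) || ((row lam i.+1).+1 < row lam i)).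
    rewrite eE => /andP[l0 KT]; rewrite l0 /=.
    have := Smax _ _ KT; rewrite /maxbox !mem_SD => /(_ ltac:(lia)); lia.
  rewrite /strip_row lm /=; apply/andP; split; first exact/implyP.
  case: ifP => oK; [apply/andP; split|].
  + rewrite leqNgt; apply/negP => h.
    have s1 : (i.+1, i.+1 + (row lam i - ffext e i)) \in strip mu lam e by rewrite mem_strip; lia.
    have s2 : (i.+1, (i.+1 + (row lam i - ffext e i)).+1) \in strip mu lam e by rewrite mem_strip; lia.
    move: s1 s2; rewrite !SE => s1 s2.
    by have [_ /(_ erefl)] := row_ _ _ _ _ _ (ltnSn _) s1 s2; rewrite /= oK.
  + apply/implyP => hP; rewrite -[X in X || _]negbK -lt0n -implyNb negbK; apply/implyP => m0.
    rewrite lt0n; apply/eqP => l0.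
    have : (i.+1, i.+1) \in strip mu lam e by rewrite mem_strip l0; lia.
    by rewrite SE => /(diag hP); rewrite /= oK.
  have [m0|m0] := posnP (row mu i.+1); first by rewrite m0 orbT.
  rewrite orbF ltnNge; apply/negP => h.
  have s1 : (i.+1, i.+1 + row mu i.+1) \in strip mu lam e.
    by rewrite mem_strip; have := row_strict mu i; lia.
  have s2 : (i.+2, i.+1 + row mu i.+1) \in strip mu lam e.
    rewrite mem_strip; have := row_strict lam i; have := lm i.+1; have := lm i; lia.
  move: s1 s2; rewrite !SE => s1 s2.
  by have [_ /(_ erefl)] := col _ _ _ _ _ (ltnSn _) s1 s2; rewrite /= oK.
- split=> //.
  + by move=> i j a; rewrite mem_del_letter => /andP[a1 aT];
      apply: (lammem _ _ _ aT); have := let_ _ _ _ aT; lia.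
  + move=> i j h1 h2; have [h|[a aT aK]] := memlam _ _ h1; first by rewrite h in h2.
    by exists a; rewrite mem_del_letter aT andbT; lia.
  + by move=> i j a; rewrite mem_del_letter => /andP[_ /maxb].
  + by move=> i j a; rewrite mem_del_letter => /andP[a1 /let_]; lia.
  + by move=> i j j' a a' jj'; rewrite !mem_del_letter => /andP[_ h1] /andP[_ h2]; apply: row_ h1 h2.
  + by move=> i i' j a a' ii'; rewrite !mem_del_letter => /andP[_ h1] /andP[_ h2]; apply: col h1 h2.
  + by move=> hP j a; rewrite mem_del_letter => /andP[_ /(diag hP)].
apply: filling_eq => i j a; rewrite mem_add_letter mem_del_letter SE.
by case: eqVneq => [->|_]; rewrite ?andbT ?andbF ?orbF.
Qed.

(** Deleting [K.+1] recovers the smaller tableau, its support together with [nu] recovers [lam], and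
    the row ends of [lam] recover the flags. *)
Lemma add_letter_inj lam lam' (e e' : {ffun 'I_n -> bool}) T T' :
  ell lam <= n -> ell lam' <= n ->
  strip_ok P K.+1 mu lam e -> strip_ok P K.+1 mu lam' e' ->
  gtab P K lam nu T -> gtab P K lam' nu T' ->
  add_letter K.+1 (strip mu lam e) T = add_letter K.+1 (strip mu lam' e') T' ->
  [/\ lam = lam', e = e' & T = T'].
Proof.
move=> ln ln' ok ok' gT gT' eqT.
have TE : T = T'.
  apply: filling_eq => i j a; move/fsfunP: eqT => /(_ (i, j))/fsetP/(_ a).
  rewrite !mem_add_letter; case: (eqVneq a K.+1) => [->|_]; last by rewrite !andbF !orbF.
  move=> _; have nK l X : gtab P K l nu X -> (K.+1 \in X (i, j)) = false.
    by move=> gX; apply/negbTE/negP => /(gtab_letter gX); rewrite ltnn andbF.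
  by rewrite (nK _ _ gT) (nK _ _ gT').
have SDE l X : gtab P K l nu X -> SD l = SD nu `|` finsupp X.
  move=> gX; apply/fsetP => -[i j]; rewrite in_fsetU; apply/idP/idP => [h|].
    case: (boolP (_ \in SD nu)) => //= hn; apply/mem_finsuppP.
    exact: (gtab_full gX).
  case/orP => [|/mem_finsuppP[a /(gtab_supp gX)//]].
  by case: i => [|i]; rewrite ?mem_SD0 // !mem_SD; have := gtab_sub gX i; lia.
have lE : lam = lam' by apply: SD_inj; rewrite (SDE _ _ gT) (SDE _ _ gT') TE.
split=> //; rewrite -{}lE -{}TE {gT' ln' SDE} in ok' eqT *.
have nK i j : (K.+1 \in T (i, j)) = false.
  by apply/negbTE/negP => /(gtab_letter gT); rewrite ltnn andbF.
apply/ffunP => o; rewrite -!ffext_ord.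
move/fsfunP: eqT => /(_ (o.+1, o + row lam o))/fsetP/(_ K.+1).
rewrite !mem_add_letter nK eqxx !andbT !orFb !mem_strip.
have /and3P[lm h1 _] := strip_okE o mun ln ok.
have /and3P[_ h2 _] := strip_okE o mun ln ok'.
by case: (ffext e o) h1; case: (ffext e' o) h2 => /=; lia.
Qed.

End Peel.

Section Tabs.
Variables (n B : nat) (P : bool) (nu : spart).

(** Enumeration by successive peeling, so that weighted sums over the list obey a matrix recursion
    by construction. Without letters only the empty filling of [nu // nu] exists. *)
Fixpoint tabs (K : nat) (mu : spart) : seq filling :=
  if K is K'.+1 then
    [seq add_letter K (strip mu le.1 le.2) T
      | le <- [seq le <- [seq (lam, e) | lam <- sparts B n, e <- enum {ffun 'I_n -> bool}]
                 | strip_ok P K mu le.1 le.2],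
        T <- tabs K' le.1]
  else if mu == nu then [:: [fsfun]] else [::].

Lemma tabsP K mu T : ell mu <= n -> row mu 0 <= B ->
  T \in tabs K mu <-> gtab P K mu nu T.
Proof.
elim: K mu T => [|K IH] mu T mn mB.
  rewrite [tabs _ _]/=; split.
    case: eqVneq => // ->; rewrite inE => /eqP->.
    have m0 b a : (a \in ([fsfun] : filling) b) = false by rewrite fsfun0E.
    split=> //.
    + by move=> i j a; rewrite m0.
    + by move=> i j h /negP[].
    + by move=> i j a; rewrite m0.
    + by move=> i j a; rewrite m0.
    + by move=> i j j' a a' _; rewrite m0.
    + by move=> i i' j a a' _; rewrite m0.
    + by move=> _ j a; rewrite m0.
  move=> g.
  have T0 i j : T (i, j) = fset0.
    by apply/fsetP => a; rewrite in_fset0; apply/negbTE/negP => /(gtab_letter g); lia.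
  have -> : mu = nu.
    apply: SD_inj; apply/fsetP => -[[|i] j]; first by rewrite !mem_SD0.
    apply/idP/idP => h; last by move: h; rewrite !mem_SD; have := gtab_sub g i; lia.
    apply/negPn/negP => /(gtab_full g h)[a]; rewrite T0 //.
  by rewrite eqxx inE; apply/eqP/filling_eq => i j a; rewrite T0 fsfun0E.
rewrite [tabs _ _]/=; split.
  case/allpairsPdep => -[lam e] [T' []]; rewrite mem_filter => /andP[/= ok /allpairsP[[l f] []]].
  rewrite mem_sparts /= => /andP[lB ln] _ [lE fE]; subst l f.
  by move=> /(IH _ _ ln lB) gT' ->; apply: gtab_extend.
move=> /(gtab_peel mn)[lam [e [T' [ln lm ok gT' ->]]]]; apply/allpairsPdep.
have lB := leq_trans lm mB.
exists (lam, e), T'; rewrite mem_filter ok /=; split=> //; last exact/IH.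
by apply/allpairsP; exists (lam, e); rewrite mem_sparts lB ln mem_enum.
Qed.

Lemma uniq_tabs K mu : ell mu <= n -> row mu 0 <= B -> uniq (tabs K mu).
Proof.
elim: K mu => [|K IH] mu mn mB; first by rewrite /=; case: eqP.
have sub le : le \in [seq le <- [seq (lam, e) | lam <- sparts B n, e <- enum {ffun 'I_n -> bool}]
    | strip_ok P K.+1 mu le.1 le.2] ->
    [/\ ell le.1 <= n, row le.1 0 <= B & strip_ok P K.+1 mu le.1 le.2].
  rewrite mem_filter => /andP[ok /allpairsP[[l f] []]].
  by rewrite mem_sparts => /andP[/= lB ln] _ leE; move: ok; rewrite leE.
apply: allpairs_uniq_dep.
- apply/filter_uniq/allpairs_uniq; [exact: uniq_sparts|exact: enum_uniq|].
  by move=> [l e] [l' e'] _ _ [-> ->].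
- by move=> le /sub[ln lB _]; apply: IH.
move=> [le T] [le' T'] /allpairsPdep[x [y [/sub[ln lB ok] yT [xE yE]]]].
move=> /allpairsPdep[x' [y' [/sub[ln' lB' ok'] yT' [xE' yE']]]]; subst.
have gy : gtab P K x.1 nu y by apply/(tabsP K _ ln lB).
have gy' : gtab P K x'.1 nu y' by apply/(tabsP K _ ln' lB').
move=> /(add_letter_inj mn ln ln' ok ok' gy gy')[/= e1 e2 ->].
by move: e1 e2; case: (x) => l e; case: (x') => l' e' /= -> ->.
Qed.

End Tabs.

(** * Generating functions of tableaux *)

Local Open Scope ring_scope.

Lemma card_rows n (D : {fset nat * nat}) (lo hi : nat -> nat) :
  (forall j, (0%N, j) \notin D) ->
  (forall i j, ((i.+1, j) \in D) = (i < n)%N && (i.+1 + lo i <= j < i.+1 + hi i)%N) ->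
  #|` D| = (\sum_(i < n) (hi i - lo i))%N.
Proof.
move=> D0 DE.
pose L := [seq (i.+1, j) | i <- iota 0 n, j <- iota (i.+1 + lo i) (hi i - lo i)].
have uL : uniq L.
  apply: allpairs_uniq_dep => [|i _|]; [exact: iota_uniq|exact: iota_uniq|].
  by move=> [i j] [i' j'] _ _ /= [-> ->].
have /perm_size -> : perm_eq D L.
  apply: uniq_perm => // -[[|i] j].
    rewrite (negbTE (D0 j)); apply/esym/negbTE/negP => /allpairsPdep[x [y [_ _ []]]] //.
  rewrite DE; apply/idP/idP => [h|/allpairsPdep[x [y []]]].
    by apply/allpairsPdep; exists i, j; rewrite !mem_iota; split=> //; lia.
  by rewrite !mem_iota => h1 h2 [-> ->]; lia.
rewrite size_allpairs_dep sumnE big_map -(big_mkord xpredT (fun i => hi i - lo i)%N).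
by rewrite /index_iota subn0; apply: eq_bigr => i _; rewrite size_iota.
Qed.

Lemma skew_size_rows n (lam mu : spart) : (ell lam <= n)%N ->
  skew_size lam mu = (\sum_(i < n) (row lam i - row mu i))%N.
Proof.
move=> ln; apply: card_rows => [j|i j]; rewrite inE ?mem_SD0 ?andbF // !mem_SD.
have [lt|ge] := ltnP i n; first by lia.
by rewrite (row_eq0 (leq_trans ln ge)); lia.
Qed.

Lemma card_strip n (mu lam : spart) (e : {ffun 'I_n -> bool}) : (ell mu <= n)%N ->
  #|` strip mu lam e| = (\sum_(i < n) (row mu i - (row lam i - e i)))%N.
Proof.
move=> mn; rewrite (card_rows (n := n) (lo := fun i => (row lam i - ffext e i)%N) (hi := row mu)).
- by apply: eq_bigr => i _; rewrite ffext_ord.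
- by move=> j; rewrite mem_strip0.
move=> i j; rewrite mem_strip; have [lt|ge] := ltnP i n; first by lia.
by rewrite (row_eq0 (leq_trans mn ge)); lia.
Qed.

(** The constant weight 1 yields the size of [T]; the weight [D ^ letter_index a] yields an exponent
    that encodes all multiplicities of [T]. *)
Definition lettersum (f : nat -> nat) (T : filling) : nat :=
  (\sum_(b <- finsupp T) \sum_(a <- T b) f a)%N.

Lemma lettersum_incl f (T : filling) (D : {fset nat * nat}) : finsupp T `<=` D ->
  lettersum f T = (\sum_(b <- D) \sum_(a <- T b) f a)%N.
Proof.
move=> sub; apply: big_fset_incl => // b bD bT.
by rewrite fsfun_dflt // big_seq_fset0.
Qed.

Lemma lettersum_add_letter f K S (T : filling) : (forall b, K \notin T b) ->
  lettersum f (add_letter K S T) = (lettersum f T + #|` S| * f K)%N.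
Proof.
move=> KT; rewrite (lettersum_incl f (D := finsupp T `|` S)); last first.
  apply/fsubsetP => b /mem_finsuppP[a]; rewrite mem_add_letter in_fsetU.
  by case/orP => [aT|/andP[->]]; rewrite ?orbT //; apply/orP; left; apply/mem_finsuppP; exists a.
rewrite (lettersum_incl f (D := finsupp T `|` S)) ?fsubsetUl //.
have E b : (\sum_(a <- add_letter K S T b) f a = \sum_(a <- T b) f a + (b \in S) * f K)%N.
  have -> : add_letter K S T b = if b \in S then K |` T b else T b.
    by apply/fsetP => a; rewrite mem_add_letter; case: ifP => _; rewrite ?orbF // in_fset1U orbC.
  case: ifP => _; last by rewrite addn0.
  by rewrite big_fsetU1 //= mul1n addnC.
rewrite (eq_bigr _ (fun b _ => E b)) big_split /=; congr addn.
rewrite -big_distrl /=; congr muln.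
rewrite -(big_fset_incl _ (fsubsetUr (finsupp T) S)); last by move=> c _ /negbTE->.
by rewrite -sum1_size !big_seq; apply: eq_bigr => c ->.
Qed.

Section Weights.
Variables (R : comNzRingType) (b z : R) (f : nat -> nat) (n B : nat) (P : bool) (nu : spart).

Definition tabweight (mu : spart) (T : filling) : R :=
  b ^+ (tab_size T - skew_size mu nu) * z ^+ lettersum f T.

Definition tabsum (K : nat) (mu : spart) : R :=
  \sum_(T <- tabs n B P nu K mu) tabweight mu T.

Definition mxletter (K : nat) (y : R) : spart -> spart -> R :=
  if odd K then (if P then mxVP b n y else mxV b n y) else mxH b n y.

Lemma tab_sizeE T : tab_size T = lettersum (fun=> 1%N) T.
Proof. by apply: eq_bigr => c _; rewrite sum1_size. Qed.

Lemma leq_skew_tab_size K mu T : gtab P K mu nu T -> (skew_size mu nu <= tab_size T)%N.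
Proof.
move=> g; rewrite /skew_size.
have sub : skewSD mu nu `<=` finsupp T.
  apply/fsubsetP => -[i j]; rewrite inE => /andP[h1 h2]; apply/mem_finsuppP.
  exact: gtab_full g _ _ h2 h1.
apply: leq_trans (fsubset_leq_card sub) _.
rewrite -sum1_size; rewrite /tab_size !big_seq; apply: leq_sum => c; rewrite mem_finsupp => h.
by rewrite cardfs_gt0.
Qed.

(** The strip consists of [mu/lam] and one reused box of [lam] for each flag, so the exponent of [b]
    grows by exactly the number of flags. *)
Lemma tabweight_add_letter K mu lam e T : (ell mu <= n)%N -> (ell lam <= n)%N ->
  strip_ok P K.+1 mu lam e -> gtab P K lam nu T ->
  tabweight mu (add_letter K.+1 (strip (n := n) mu lam e) T) =
  \prod_(i < n) (b ^+ e i * (z ^+ f K.+1) ^+ (row mu i - (row lam i - e i))) * tabweight lam T.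
Proof.
move=> mn ln ok g.
have KT c : K.+1 \notin T c.
  by case: c => i j; apply/negP => /(gtab_letter g); rewrite ltnn andbF.
rewrite /tabweight tab_sizeE !lettersum_add_letter // -tab_sizeE muln1.
have le := leq_skew_tab_size g.
have h : (#|` strip mu lam e| + skew_size lam nu = \sum_(i < n) e i + skew_size mu nu)%N.
  rewrite card_strip // !(skew_size_rows _ (n := n)) // -!big_split; apply: eq_bigr => i _ /=.
  have /and3P[h1 h2 _] := strip_okE i mn ln ok; have := gtab_sub g i.
  by move: h2; rewrite ffext_ord; case: (e i); lia.
have -> : (tab_size T + #|` strip mu lam e| - skew_size mu nu =
  (\sum_(i < n) e i) + (tab_size T - skew_size lam nu))%N by lia.
rewrite big_split /= !prodrXr card_strip // !exprD mulnC exprM.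
by rewrite [z ^+ _ * _]mulrC mulrACA.
Qed.

(** Origin of the row weights: where both values of the flag are allowed and the row end is free,
    they contribute 1 and [b * y], hence the factor [1 + b * y]. A primed letter in a row extended
    by one box must occupy exactly that box, which leaves [y]. *)
Lemma strip_row_sum K (y : R) (mi mi1 li li1 : nat) :
  strict0 mi mi1 -> strict0 li li1 -> (li1 <= mi1)%N ->
  \sum_(e : bool | strip_row P K mi mi1 li li1 e) b ^+ e * y ^+ (mi - (li - e)) =
  if odd K then (if P then wVP b y mi li li1 else wV b y mi li li1) else wH b y mi li mi1.
Proof.
move=> sm sl lm; rewrite big_mkcond big_bool /= subn0 subn1 expr1 mul1r.
rewrite /strip_row; case: (odd K); last first.
  rewrite /wH; case: li sl => [|li] sl /=; first by split_ifs; rewrite ?subn0; ring.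
  rewrite subn0; split_ifs; try (have -> : (mi - li = (mi - li.+1).+1)%N by lia); rewrite ?exprS; ring.
rewrite /wV /wVP sl /=; rewrite /strict0 in sm sl.
case: li sl lm => [|li] sl lm /=.
  case: P => /=; split_ifs; rewrite ?subn0; try ring;
    try (have -> : mi = 0%N by lia); try (have -> : mi = 1%N by lia); ring.
case: P => /=; split_ifs; try ring;
  try (have -> : mi = li.+1 by lia); try (have -> : mi = li.+2 by lia);
  rewrite ?subSnn ?subnn; ring.
Qed.

Lemma tabsumS K mu : (ell mu <= n)%N -> (row mu 0 <= B)%N ->
  tabsum K.+1 mu = \sum_(lam <- sparts B n) mxletter K.+1 (z ^+ f K.+1) mu lam * tabsum K lam.
Proof.
move=> mn mB; rewrite /tabsum /= big_allpairs_dep /= big_filter big_mkcond /=.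
rewrite big_allpairs_dep /= !big_seq; apply: eq_bigr => lam; rewrite mem_sparts => /andP[lB ln].
rewrite big_enum /= -big_mkcond /=.
transitivity (\sum_(e : {ffun 'I_n -> bool} | strip_ok P K.+1 mu lam e)
  \prod_(i < n) (b ^+ e i * (z ^+ f K.+1) ^+ (row mu i - (row lam i - e i))) * tabsum K lam).
  apply: eq_bigr => e ok; rewrite /tabsum mulr_sumr big_seq [RHS]big_seq; apply: eq_bigr => T.
  move=> /(tabsP _ _ _ _ ln lB) g; exact: tabweight_add_letter.
rewrite -mulr_suml; congr (_ * _).
have -> : mxletter K.+1 (z ^+ f K.+1) mu lam = \prod_(i < n)
  (if odd K.+1 then (if P then wVP b (z ^+ f K.+1) (row mu i) (row lam i) (row lam i.+1)
     else wV b (z ^+ f K.+1) (row mu i) (row lam i) (row lam i.+1))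
   else wH b (z ^+ f K.+1) (row mu i) (row lam i) (row mu i.+1)).
  by rewrite /mxletter; case: (odd _); case: P.
transitivity (\prod_(i < n) \sum_(e : bool |
    strip_row P K.+1 (row mu i) (row mu i.+1) (row lam i) (row lam i.+1) e)
    b ^+ e * (z ^+ f K.+1) ^+ (row mu i - (row lam i - e))).
  rewrite bigA_distr_big_dep /=; apply: eq_bigl => e; rewrite /strip_ok.
  by apply/forallP/familyP => h i; have := h i; rewrite unfold_in.
(* [strip_row_sum] needs containment of the rows below; if some row of [lam] exceeds that of [mu],
   both products contain a zero factor. *)
case: (boolP [forall i : 'I_n, row lam i <= row mu i]%N) => [/forallP h|].
  apply: eq_bigr => i _; apply: strip_row_sum; try exact: strict_row.
  have [lt|ge] := ltnP i.+1 n; first exact: (h (Ordinal lt)).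
  by rewrite row_eq0 // (leq_trans ln).
rewrite negb_forall => /existsP[i]; rewrite -ltnNge => h.
rewrite (bigD1 i) //= [in RHS](bigD1 i) //= big_pred0 ?mul0r; last first.
  by move=> e; rewrite /strip_row leqNgt h.
apply/esym; set X := (X in X * _); suff -> : X = 0 by rewrite mul0r.
by rewrite /X /wH /wV /wVP; case: (odd _); case: P; split_ifs.
Qed.

End Weights.

(** * Conjugation by A, one pair of letters at a time *)

Section MatrixProduct.
Variables (R : comNzRingType) (U : seq spart).
Implicit Types X Y Z : spart -> spart -> R.

Definition mxprod X Y (a c : spart) : R := \sum_(d <- U) X a d * Y d c.

Lemma mxprodA X Y Z a c : mxprod (mxprod X Y) Z a c = mxprod X (mxprod Y Z) a c.
Proof.
rewrite /mxprod; under eq_bigr => d _ do rewrite mulr_suml.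
rewrite exchange_big; apply: eq_bigr => d _; rewrite mulr_sumr.
by apply: eq_bigr => d' _; rewrite mulrA.
Qed.

(** The guard [X a d != 0] carries containment: it keeps the first row of [d] within the range where
    the identities between the truncated matrices hold. *)
Lemma eq_mxprodr X Y Y' a c : {in U, forall d, X a d != 0 -> Y d c = Y' d c} ->
  mxprod X Y a c = mxprod X Y' a c.
Proof.
move=> h; rewrite /mxprod !big_seq; apply: eq_bigr => d dU.
by have [->|/(h _ dU)->//] := eqVneq (X a d) 0; rewrite !mul0r.
Qed.

Lemma eq_mxprodl X X' Y a c : {in U, X a =1 X' a} -> mxprod X Y a c = mxprod X' Y a c.
Proof. by move=> h; rewrite /mxprod !big_seq; apply: eq_bigr => d dU; rewrite h. Qed.

Lemma mxprod1l Y a c : uniq U -> a \in U -> mxprod (fun d d' => (d == d')%:R) Y a c = Y a c.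
Proof.
move=> uU aU; rewrite /mxprod (bigD1_seq a) //= eqxx mul1r big1 ?addr0 // => d.
by rewrite eq_sym => /negbTE->; rewrite mul0r.
Qed.

Lemma mxprod1r Y a c : uniq U -> c \in U -> mxprod Y (fun d d' => (d == d')%:R) a c = Y a c.
Proof.
move=> uU aU; rewrite /mxprod (bigD1_seq c) //= eqxx mulr1 big1 ?addr0 // => d.
by move/negbTE->; rewrite mulr0.
Qed.

End MatrixProduct.

Section Conjugation.
Variables (R : comNzRingType) (b z : R) (f : nat -> nat) (n B : nat).
(* The letters i' and i carry the same variable. *)
Hypothesis f_pair : forall i, f i.*2.+1 = f i.*2.+2.

Definition mxtab (P : bool) (K : nat) (mu nu : spart) : R := tabsum b z f n B P nu K mu.

Lemma mxletter_sub (x : R) mu lam K P : (ell mu <= n)%N -> (ell lam <= n)%N ->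
  mxletter b n P K x mu lam != 0 -> (row lam 0 <= row mu 0)%N.
Proof.
have [n0 mn ln _|n0 mn ln] := posnP n; first by rewrite (row_eq0 (i := 0%N)) // -n0.
move=> nz; rewrite leqNgt; apply: contra nz => h.
rewrite /mxletter /mxVP /mxV /mxH; case: ifP => _; [case: ifP => _|];
  rewrite (bigD1 (Ordinal n0)) //= /wVP /wV /wH; split_ifs; by rewrite ?mul0r.
Qed.

Lemma mxtab0 P mu nu : mxtab P 0 mu nu = (mu == nu)%:R.
Proof.
rewrite /mxtab /tabsum /=; case: eqVneq => _; last by rewrite big_nil.
rewrite big_seq1 /tabweight tab_sizeE /lettersum finsupp0 !big_seq_fset0 sub0n !expr0 mulr1 //.
Qed.

Lemma mxtabS P K mu nu : (ell mu <= n)%N -> (row mu 0 <= B)%N ->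
  mxtab P K.+1 mu nu = mxprod (sparts B n) (mxletter b n P K.+1 (z ^+ f K.+1)) (mxtab P K) mu nu.
Proof. exact: tabsumS. Qed.

Lemma mxtab_sub P K mu nu : (ell mu <= n)%N -> (row mu 0 <= B)%N ->
  mxtab P K mu nu != 0 -> (row nu 0 <= row mu 0)%N.
Proof.
move=> mn mB; rewrite /mxtab /tabsum; case E: (tabs _ _ _ _ _ _) => [|T s]; first by rewrite big_nil eqxx.
have : T \in tabs n B P nu K mu by rewrite E inE eqxx.
by move=> /(tabsP _ _ _ _ mn mB) /gtab_sub.
Qed.

(** With [x] the variable of the outermost pair of letters, H V F_Q A = H V A F_P = H A' VP F_P = A
    H VP F_P. The strict bound on [mu] leaves room for [A] to lengthen its first row, and it is
    inherited because [H] and [V] never lengthen rows. *)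
Lemma mxtab_conj N mu rho : (ell mu <= n)%N -> (row mu 0 < B)%N -> rho \in sparts B n ->
  mxprod (sparts B n) (mxtab false N.*2) (mxA b n) mu rho =
  mxprod (sparts B n) (mxA b n) (mxtab true N.*2) mu rho.
Proof.
move=> mn mB rU; have uU := uniq_sparts B n.
elim: N mu mn mB => [|N IH] mu mn mB.
  have mU : mu \in sparts B n by rewrite mem_sparts mn ltnW.
  rewrite (eq_mxprodl (X' := fun d d' => (d == d')%:R)); last by move=> d _; apply: mxtab0.
  rewrite [RHS](eq_mxprodr (Y' := fun d d' => (d == d')%:R)); last by move=> d _ _; apply: mxtab0.
  by rewrite mxprod1l // mxprod1r.
set U := sparts B n in IH rU uU *; set x := z ^+ f N.*2.+1.
have TE P lam nu : lam \in U -> mxtab P N.+1.*2 lam nu =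
    mxprod U (mxH b n x) (mxprod U (mxletter b n P N.*2.+1 x) (mxtab P N.*2)) lam nu.
  rewrite mem_sparts => /andP[lB ln]; rewrite doubleS mxtabS // /mxletter /= odd_double /= -f_pair.
  apply: eq_mxprodr => d; rewrite mem_sparts => /andP[dB dn] _.
  by rewrite mxtabS // /mxletter /= odd_double.
have mU : mu \in U by rewrite mem_sparts mn ltnW.
rewrite (eq_mxprodl (X' := mxprod U (mxH b n x) (mxprod U (mxV b n x) (mxtab false N.*2)))); last first.
  by move=> nu _; rewrite TE // /mxletter /= odd_double.
rewrite mxprodA.
have smallH d : d \in U -> mxH b n x mu d != 0 -> (row d 0 < B)%N.
  rewrite mem_sparts => /andP[dB dn] nz; apply: leq_trans mB; rewrite ltnS.
  by apply: (mxletter_sub (x := x) (K := 0) (P := false)).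
transitivity (mxprod U (mxH b n x) (mxprod U (mxA' b n x)
    (mxprod U (mxVP b n x) (mxtab true N.*2))) mu rho).
  apply: eq_mxprodr => sig sU /(smallH _ sU) sB; move: sU; rewrite mem_sparts => /andP[_ sn].
  rewrite mxprodA.
  transitivity (mxprod U (mxV b n x) (mxprod U (mxA b n) (mxtab true N.*2)) sig rho).
    apply: eq_mxprodr => tau; rewrite mem_sparts => /andP[tB tn] nz; apply: IH => //.
    apply: leq_trans sB; rewrite ltnS.
    by apply: (mxletter_sub (x := x) (K := 1) (P := false)).
  rewrite -!mxprodA; apply: eq_mxprodl => tau; rewrite mem_sparts => /andP[tB tn].
  exact: mxVA.
rewrite -mxprodA.
transitivity (mxprod U (mxprod U (mxA b n) (mxH b n x))
    (mxprod U (mxVP b n x) (mxtab true N.*2)) mu rho).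
  apply: eq_mxprodl => tau; rewrite mem_sparts => /andP[tB tn].
  by symmetry; apply: mxAH.
rewrite mxprodA; apply: eq_mxprodr => lam lU _.
by rewrite TE // /mxletter /= odd_double.
Qed.

Lemma mxtab_expand (c : R) N mu nu : 2 * c = 1 -> (ell mu <= n)%N -> (row mu 0 < B)%N ->
  nu \in sparts B n ->
  mxtab false N.*2 mu nu =
  \sum_(lam <- sparts B n) \sum_(kap <- sparts B n)
    mxA b n mu lam * mxB b n c kap nu * mxtab true N.*2 lam kap.
Proof.
move=> c2 mn mB nuU; have uU := uniq_sparts B n.
rewrite -(mxprod1r (U := sparts B n) (mxtab false N.*2) mu uU nuU).
transitivity (mxprod (sparts B n) (mxtab false N.*2)
    (mxprod (sparts B n) (mxA b n) (mxB b n c)) mu nu).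
  apply: eq_mxprodr => d; rewrite mem_sparts => /andP[dB dn] nz.
  move: nuU; rewrite mem_sparts => /andP[_ nun].
  by rewrite [RHS](mxAB b c2 dn nun) //; apply: leq_ltn_trans (mxtab_sub mn (ltnW mB) nz) mB.
rewrite -mxprodA.
transitivity (mxprod (sparts B n) (mxprod (sparts B n) (mxA b n) (mxtab true N.*2))
    (mxB b n c) mu nu).
  by apply: eq_mxprodl => d dU; apply: mxtab_conj.
rewrite mxprodA /mxprod; apply: eq_bigr => lam _; rewrite mulr_sumr.
by apply: eq_bigr => kap _; rewrite -mulrA [mxB _ _ _ _ _ * _]mulrC.
Qed.

End Conjugation.

(** * Comparison with the skew functions GP and GQ *)

Local Open Scope nat_scope.

Lemma spsubP (nu mu : spart) : spsub nu mu <-> forall i, row nu i <= row mu i.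
Proof. by split=> [h i|h [|i] // _]; [exact: (h i.+1)|exact: h]. Qed.

Lemma spsub_SD (nu mu : spart) : spsub nu mu <-> {subset SD nu <= SD mu}.
Proof.
split=> [/spsubP h [[|i] j]|h]; rewrite ?mem_SD0 //.
  by rewrite !mem_SD; have := h i; lia.
apply/spsubP => i; have [->//|n0] := posnP (row nu i).
have : (i.+1, i + row nu i) \in SD mu by apply: h; rewrite mem_SD; lia.
by rewrite mem_SD; lia.
Qed.

Lemma removableP (mu : spart) i j : removable mu (i, j) <-> maxbox mu i j.
Proof.
split=> [[ij [rho rhoE]]|/and3P[ij nr nd]].
  have nij : (i, j) \notin SD rho by rewrite rhoE in_fsetD1 eqxx.
  have gt0 := mem_SD_gt0 ij.
  rewrite /maxbox ij /=; apply/andP; split; apply: contra nij => h.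
    have : (i, j.+1) \in SD rho by rewrite rhoE in_fsetD1 h andbT xpair_eqE; lia.
    by move/SD_ideal; apply; lia.
  have : (i.+1, j) \in SD rho by rewrite rhoE in_fsetD1 h andbT xpair_eqE; lia.
  by move/SD_ideal; apply; lia.
split=> //; apply: spart_of_ideal => [i' j'|i' j' k l].
  by rewrite in_fsetD1 => /andP[_ /mem_SD_gt0].
rewrite !in_fsetD1 => /andP[ne h] hk hl; rewrite (SD_ideal h) // andbT.
apply/eqP => -[ki lj]; subst k l; move: ne; rewrite xpair_eqE negb_and => ne.
have [lt|ge] := ltnP j j'.
  by move/negP: nr; apply; apply: (SD_ideal h); lia.
by move/negP: nd; apply; apply: (SD_ideal h); have := mem_SD_gt0 h; lia.
Qed.

Definition SetShYT (P : bool) (lam mu : spart) (T : filling) : Prop :=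
  if P then SetShYT_P lam mu T else SetShYT_Q lam mu T.

Lemma SetShYTE P lam mu T : SetShYT P lam mu T <->
  SetShYT_Q lam mu T /\
  (P -> forall j, (j, j) \in skewSD lam mu -> forall a, a \in T (j, j) -> ~~ primed a).
Proof.
rewrite /SetShYT; case: P; rewrite /SetShYT_P.
  by split=> -[h1 h2]; split=> //; apply: h2.
by split=> [h|[]].
Qed.

Lemma SetShYT_gtab P K mu nu nu' (T : filling) : spsub nu mu -> (forall b a, a \in T b -> a <= K) ->
  rem_sub nu nu' -> SetShYT P mu nu' T -> gtab P K mu nu T.
Proof.
move=> sub TK [sub' rem] /SetShYTE[[supp T0 [rowT colT] colT' rowT'] diag].
have inD i j a : a \in T (i, j) -> (i, j) \in skewSD mu nu'.
  by move=> aT; rewrite -supp; apply/mem_finsuppP; exists a.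
have inl i j : (i, j) \in SD nu' -> (i, j) \in SD nu by move/spsub_SD: sub'; apply.
split.
- exact/spsubP.
- by move=> i j a /inD; rewrite in_fsetD => /andP[].
- move=> i j h1 h2; apply/mem_finsuppP; rewrite supp in_fsetD h1 andbT.
  by apply: contra h2; apply: inl.
- move=> i j a /inD; rewrite in_fsetD => /andP[h1 h2] h3; apply/removableP; apply: rem.
  by rewrite in_fsetD h1 h3.
- move=> i j a aT; rewrite (TK _ _ aT) andbT lt0n; apply/eqP => a0; subst a.
  by move: (T0 _ (inD _ _ _ aT)); rewrite aT.
- move=> i j j' a a' jj' aT aT'; split.
    exact: (rowT _ _ (inD _ _ _ aT) (inD _ _ _ aT') erefl jj' a a').
  move=> e; subst a'; apply/negP => oa.
  apply: (rowT' _ _ (inD _ _ _ aT) (inD _ _ _ aT') erefl _ a oa) => //.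
  by move=> [e]; rewrite e ltnn in jj'.
- move=> i i' j a a' ii' aT aT'; split.
    exact: (colT _ _ (inD _ _ _ aT) (inD _ _ _ aT') erefl ii' a a').
  move=> e; subst a'; apply/negPn/negP => oa.
  apply: (colT' _ _ (inD _ _ _ aT) (inD _ _ _ aT') erefl _ a oa) => //.
  by move=> [e]; rewrite e ltnn in ii'.
by move=> hP j a aT; apply: (diag hP _ (inD _ _ _ aT)).
Qed.

(** The witness is [nu] without its filled boxes. These boxes are maximal in [nu], so the remaining
    boxes still form a diagram. *)
Lemma gtab_SetShYT P K mu nu T : gtab P K mu nu T ->
  exists2 nu', rem_sub nu nu' & SetShYT P mu nu' T.
Proof.
move=> [sub supp full maxb let_ row_ col diag].
have [nu' nuE] : exists nu', SD nu' = SD nu `\` finsupp T.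
  apply: spart_of_ideal => [i j|i j i' j']; first by rewrite in_fsetD => /andP[_ /mem_SD_gt0].
  rewrite !in_fsetD => /andP[nT h] hi hj; rewrite (SD_ideal h) // andbT.
  apply: contra nT => /mem_finsuppP[a aT].
  have /and3P[_ m1 m2] := maxb _ _ _ aT (SD_ideal h hi hj).
  have [lt|ge] := ltnP j' j.
    by move/negP: m1; case; apply: (SD_ideal h); lia.
  have [lt|ge'] := ltnP i' i.
    by move/negP: m2; case; apply: (SD_ideal h); have := mem_SD_gt0 h; lia.
  have -> : i = i' by lia.
  have -> : j = j' by lia.
  by apply/mem_finsuppP; exists a.
have DE : finsupp T = skewSD mu nu'.
  apply/fsetP => -[i j]; rewrite in_fsetD nuE in_fsetD; apply/idP/idP => [h|].
    by rewrite h /=; case/mem_finsuppP: h => a /supp.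
  move=> /andP[h1 h2]; apply/negPn/negP => nT; move: h1; rewrite nT /= => h1.
  have [a aT] := full _ _ h2 h1.
  by move/negP: nT; apply; apply/mem_finsuppP; exists a.
exists nu'; first split.
- by apply/spsub_SD => -[i j]; rewrite nuE in_fsetD => /andP[].
- move=> [i j]; rewrite in_fsetD nuE in_fsetD negb_and negbK => /andP[/orP[|/negP h1 h2]] //.
  by case/mem_finsuppP => a aT h; apply/removableP; apply: maxb aT h.
apply/SetShYTE; split; last by move=> hP j _ a; apply: diag.
split=> //.
- by move=> [i j] _; apply/negP => /let_.
- split=> -[i j] [i' j'] _ _ /= e lt a a' aT aT'; subst.
    by have [] := row_ _ _ _ _ _ lt aT aT'.
  by have [] := col _ _ _ _ _ lt aT aT'.
- move=> [i j] [i' j'] _ _ /= e ne a oa [aT aT']; subst j'.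
  have [lt|lt|e] := ltngtP i i'; last by subst.
    by have [_ /(_ erefl)] := col _ _ _ _ _ lt aT aT'; apply/negP.
  by have [_ /(_ erefl)] := col _ _ _ _ _ lt aT' aT; apply/negP.
- move=> [i j] [i' j'] _ _ /= e ne a oa [aT aT']; subst i'.
  have [lt|lt|e] := ltngtP j j'; last by subst.
    by have [_ /(_ erefl)] := row_ _ _ _ _ _ lt aT aT'; apply/negP; rewrite negbK.
  by have [_ /(_ erefl)] := row_ _ _ _ _ _ lt aT' aT; apply/negP; rewrite negbK.
Qed.

Local Open Scope ring_scope.

Lemma has_monom_letter (T : filling) (m : monom) b a :
  has_monom T m -> a \in T b -> letter_index a \in finsupp m.
Proof.
move=> hm aT; have bT : b \in finsupp T by apply/mem_finsuppP; exists a.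
rewrite mem_finsupp hm /tab_mult (big_fsetD1 b) //= addn_eq0 negb_and; apply/orP; left.
by rewrite cardfs_eq0; apply/fset0Pn; exists a; rewrite 2!inE /= aT eqxx.
Qed.

Lemma leq_double_letter_index a : (a <= (letter_index a).*2)%N.
Proof. by rewrite /letter_index; lia. Qed.

Lemma skew_size_trans (lam mu nu : spart) : spsub nu mu -> spsub mu lam ->
  (skew_size lam mu + skew_size mu nu = skew_size lam nu)%N.
Proof.
move=> /spsubP h1 /spsubP h2; pose n := maxn (ell lam) (ell mu).
rewrite !(skew_size_rows (n := n)) ?leq_max ?leqnn ?orbT // -big_split.
by apply: eq_bigr => i _ /=; have := h1 i; have := h2 i; lia.
Qed.

Lemma SetShYT_finsupp P mu nu T : SetShYT P mu nu T -> finsupp T = skewSD mu nu.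
Proof. by case/SetShYTE => -[]. Qed.

(** The tableau determines the inner shape [nu'] as the unfilled part of [mu], so the double sum
    collapses to a sum over tableaux. The powers of [beta] combine because |nu/nu'| + (|T| -
    |mu/nu'|) = |T| - |mu/nu|. Only letters whose index lies in the support of [m] can occur, hence
    the bound [K]. *)
Lemma coef_doubleslash P mu nu (m : monom) K n B :
  (ell mu <= n)%N -> (row mu 0 <= B)%N -> (forall i, i \in finsupp m -> (i.*2 <= K)%N) ->
  (if P then GPP mu nu else GQQ mu nu) m =
  \sum_(T <- tabs n B P nu K mu | `[< has_monom T m >]) beta ^+ (tab_size T - skew_size mu nu).
Proof.
move=> mn mB mK; have [sub|nsub] := pselect (spsub nu mu); last first.
  rewrite /GPP /GQQ asboolF // if_same; apply/esym; rewrite big_seq_cond big_pred0 // => T.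
  apply/negbTE/negP => /andP[/(tabsP _ _ _ _ mn mB)/gtab_sub h _].
  by apply: nsub; apply/spsubP.
have nun : (ell nu <= n)%N.
  by rewrite leqNgt -row_gt0 -leqNgt; have /spsubP/(_ n) := sub; rewrite (row_eq0 mn).
pose r := [seq nu' <- sparts B n | `[< rem_sub nu nu' >]].
have rE : rem_sub nu = [set` r].
  apply/seteqP; split=> nu' /=; rewrite mem_filter; last by case/andP => /asboolP.
  move=> h; rewrite mem_sparts; apply/and3P; split; first exact/asboolP.
    have [/spsubP/(_ 0%N) h1 _] := h; have /spsubP/(_ 0%N) h2 := sub.
    exact: leq_trans h1 (leq_trans h2 mB).
  have [/spsubP/(_ n) h1 _] := h.
  by rewrite leqNgt -row_gt0 -leqNgt; move: h1; rewrite (row_eq0 nun).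
have ur : uniq r by rewrite filter_uniq ?uniq_sparts.
transitivity (\sum_(nu' <- r) beta ^+ skew_size nu nu' *
   \sum_(T <- tabs n B P nu K mu | `[< SetShYT P mu nu' T /\ has_monom T m >])
     beta ^+ (tab_size T - skew_size mu nu')).
  have -> : (if P then GPP mu nu else GQQ mu nu) =
    \sum_(nu' <- r) beta ^+ skew_size nu nu' *: (if P then GP mu nu' else GQ mu nu').
    by rewrite /GPP /GQQ asboolT // rE -!fsbig_seq //; case: P.
  rewrite fct_sumE !big_seq; apply: eq_bigr => nu'; rewrite mem_filter => /andP[/asboolP rem _].
  have sub' : spsub nu' mu.
    by apply/spsubP => i; exact: leq_trans (proj1 (spsubP _ _) (proj1 rem) i) (proj1 (spsubP _ _) sub i).
  rewrite fps_scaleE; congr (_ * _).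
  have -> : (if P then GP mu nu' else GQ mu nu') m =
    \sum_(T \in [set T | SetShYT P mu nu' T /\ has_monom T m]) beta ^+ (tab_size T - skew_size mu nu').
    by rewrite /GP /GQ asboolT //; case: P.
  have -> : [set T | SetShYT P mu nu' T /\ has_monom T m] =
     [set` [seq T <- tabs n B P nu K mu | `[< SetShYT P mu nu' T /\ has_monom T m >]]].
    apply/seteqP; split=> T /=; rewrite mem_filter; last by case/andP => /asboolP.
    move=> h; apply/andP; split; first exact/asboolP.
    apply/(tabsP _ _ _ _ mn mB); case: h => h hm; apply: SetShYT_gtab rem h => // b a aT.
    by apply: leq_trans (leq_double_letter_index a) (mK _ (has_monom_letter hm aT)).
  by rewrite -fsbig_seq ?filter_uniq ?uniq_tabs // big_filter.
under eq_bigr => nu' _ do rewrite mulr_sumr big_mkcond.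
rewrite exchange_big /= [RHS]big_mkcond !big_seq; apply: eq_bigr => T /(tabsP _ _ _ _ mn mB) g.
have [nu0 rem0 S0] := gtab_SetShYT g.
have nu0r : nu0 \in r by have : [set` r] nu0 by rewrite -rE.
case: asboolP => hm; last by rewrite big1 // => nu' _; rewrite asboolF // => -[].
rewrite (bigD1_seq nu0) //= asboolT // big_seq_cond big1 ?addr0.
  rewrite -exprD; congr (_ ^+ _).
  have [s0 _] := rem0.
  have := skew_size_trans s0 sub; have : (skew_size mu nu0 <= tab_size T)%N.
    rewrite /skew_size -(SetShYT_finsupp S0) -sum1_size /tab_size !big_seq; apply: leq_sum => c.
    by rewrite mem_finsupp cardfs_gt0.
  by lia.
move=> nu' /andP[nu'r ne]; rewrite asboolF // => -[S1 _].
have rem1 : rem_sub nu nu' by rewrite rE.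
have SDE nu1 : rem_sub nu nu1 -> SetShYT P mu nu1 T -> SD nu1 = SD mu `\` finsupp T.
  move=> [s1 _] /SetShYT_finsupp->; rewrite /skewSD; apply/fsetP => b.
  rewrite !in_fsetD negb_and negbK andbC; have /spsub_SD/(_ b) := s1; have /spsub_SD/(_ b) := sub.
  case: (b \in SD nu1) => /= h1 h2; last by case: (b \in SD mu).
  by rewrite (h1 (h2 isT)).
by move/eqP: ne; apply; apply: SD_inj; rewrite (SDE _ rem1 S1) (SDE _ rem0 S0).
Qed.

(** * The coefficients of the expansion *)

Lemma sum_row_gt0 n (lam : spart) : (ell lam <= n)%N ->
  (\sum_(i < n) (row lam i != 0%N) = ell lam)%N.
Proof.
move=> ln; under eq_bigr => i _ do rewrite -lt0n row_gt0.
rewrite -[RHS]card_ord -sum1_card (big_ord_widen n (fun=> 1%N) ln) [RHS]big_mkcond.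
by apply: eq_bigr => i _; case: ltnP.
Qed.

Lemma ell_eq_rows (lam mu : spart) :
  (forall i, (row lam i == 0%N) = (row mu i == 0%N)) <-> ell lam = ell mu.
Proof.
split=> [h|e i]; last by apply: negb_inj; rewrite -!lt0n !row_gt0 e.
have lt i : (i < ell lam)%N = (i < ell mu)%N by rewrite -!row_gt0 !lt0n h.
by have := lt (ell lam); have := lt (ell mu); lia.
Qed.

Lemma vertical_stripP (lam mu : spart) :
  vertical_strip lam mu <-> forall i, (row lam i <= (row mu i).+1)%N.
Proof.
split=> [vs i|h [[|i] j] [[|i'] j']]; rewrite ?in_fsetD ?mem_SD0 ?andbF //.
  rewrite leqNgt; apply/negP => hj.
  have inl d : (d < 2)%N -> (i.+1, i.+1 + row mu i + d)%N \in skewSD lam mu.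
    by move=> d2; rewrite in_fsetD !mem_SD; lia.
  by have := vs _ _ (inl 0%N isT) (inl 1%N isT) erefl; case; lia.
rewrite !mem_SD => h1 h2 /= [e]; subst i'; congr (_, _).
by have := h i; lia.
Qed.

(** For a vertical strip, row [i] gains a box that is the lowest of its column:
    [row lam i.+1 = row mu i] would place a box of [lam] directly under it. *)
Definition new_col (mu lam : spart) (i : nat) : bool :=
  (row lam i == (row mu i).+1) && (row lam i.+1 != row mu i).

Lemma cols_rows n (lam mu : spart) : (ell lam <= n)%N ->
  spsub mu lam -> ell mu = ell lam -> vertical_strip lam mu ->
  cols lam mu = (\sum_(i < n) new_col mu lam i)%N.
Proof.
move=> ln /spsubP sub /ell_eq_rows el /vertical_stripP vs.
pose L := [seq (i.+1 + row mu i)%N | i <- iota 0 n & new_col mu lam i].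
have uL : uniq L.
  rewrite map_inj_in_uniq ?filter_uniq ?iota_uniq // => i i'.
  rewrite !mem_filter /new_col => /andP[/andP[/eqP e1 ne1] _] /andP[/andP[/eqP e2 ne2] _] e.
  (* If row [k'] reached the same column further down, row [k.+1] would contain the box under the
     new box of row [k]. *)
  have aux k k' : row lam k = (row mu k).+1 -> row lam k' = (row mu k').+1 ->
      row lam k.+1 != row mu k -> (k.+1 + row mu k = k'.+1 + row mu k')%N -> (k < k')%N -> False.
    move=> f1 f2 f3 f4 lt.
    have := row_diag (lam := lam) (i := k.+1) (k := (k' - k.+1)%N); rewrite subnKC // f2 => /(_ isT).
    by have := row_strict lam k; lia.
  have [lt|lt|//] := ltngtP i i'; [case: (aux i i')|case: (aux i' i)] => //.
rewrite /cols.
have /perm_size -> : perm_eq [fset b.2 | b in skewSD lam mu] L.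
  apply: uniq_perm => // j; apply/imfsetP/mapP => [[[i j0] /= ij ->]|[i]].
    move: ij; rewrite /= in_fsetD; case: i => [|i]; rewrite ?mem_SD0 ?andbF // !mem_SD => ij.
    have jE : j0 = (i.+1 + row mu i)%N by have := vs i; lia.
    have li : row lam i = (row mu i).+1 by have := vs i; lia.
    rewrite {}jE {ij}; move: li.
    (* If the new box of row [i] is not the lowest of its column, the box below it is new as well;
       the descent is bounded by [n - i]. *)
    have [k] := ubnP (n - i); elim: k i => // k IH i ik li.
    have lt : (i < n)%N by rewrite ltnNge; apply/negP => ge; rewrite (row_eq0 (leq_trans ln ge)) in li.
    case: (boolP (new_col mu lam i)) => nc.
      by exists i => //; rewrite mem_filter nc mem_iota.
    have e1 : row lam i.+1 = row mu i by move: nc; rewrite /new_col li eqxx /= negbK => /eqP.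
    have e0 : row mu i != 0%N by rewrite el li.
    have e2 : row lam i.+1 = (row mu i.+1).+1.
      by have := row_strict mu i; have := vs i.+1; lia.
    have [i0 i0L jE] := IH i.+1 ltac:(lia) e2.
    by exists i0 => //; rewrite -jE; lia.
  rewrite mem_filter => /andP[/andP[/eqP li _] _] ->.
  by exists (i.+1, i.+1 + row mu i)%N => //=; rewrite in_fsetD !mem_SD; lia.
rewrite size_map size_filter -sum1_count big_mkcond -(big_mkord xpredT (fun i => new_col mu lam i : nat)).
by rewrite /index_iota subn0; apply: eq_bigr => i _; case: new_col.
Qed.

Lemma mem_fset_sep (T : choiceType) (D : {fset T}) (Q : pred T) b :
  (b \in [fset d in D | Q d]) = (b \in D) && Q b.
Proof. by rewrite 2!inE. Qed.

(** Overlaps are counted at the lower box: it lies under a box outside [kap] exactly from position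
    [(row kap i).-1] of the next row on, and then it is outside [kap] too. The top row has nothing
    above it and receives an empty range. *)
Lemma overlap_rows n (nu kap : spart) : (ell nu <= n)%N ->
  spsub kap nu -> ell kap = ell nu ->
  overlap nu kap = (\sum_(i < n) if row nu i == 0%N then 0 else (row nu i.+1).+1 - row kap i)%N.
Proof.
move=> nn /spsubP sub /ell_eq_rows el.
rewrite /overlap (card_rows (n := n.+1)
  (lo := fun i => if i is i'.+1 then (row kap i').-1 else row nu 0%N) (hi := row nu)).
- rewrite big_ord_recl subnn add0n; apply: eq_bigr => i _; rewrite lift0 -el.
  have [k0|k0] := eqVneq (row kap i) 0%N; last by lia.
  have : row nu i == 0%N by rewrite -el k0.
  by have := row_strict nu i; lia.
- by move=> j; rewrite mem_fset_sep /= !in_fsetD !mem_SD0 !andbF.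
move=> i j; rewrite mem_fset_sep /= !in_fsetD; case: i => [|i] /=.
  by rewrite !mem_SD0 !andbF; lia.
rewrite !mem_SD.
have := el i; have := el i.+1; have := row_strict nu i; have := row_strict kap i.
have := sub i; have := sub i.+1.
have [lt|ge] := ltnP i.+1 n.+1; first by lia.
by rewrite (row_eq0 (i := i.+1) (leq_trans nn _)); lia.
Qed.

Section Coefficients.
Variables (R : comNzRingType) (b c : R) (n : nat).
Hypothesis c2 : 2 * c = 1.

(** With [c] equal to one half, an added box contributes [2 * (- (c * b)) = - b], and the sign of a
    new column turns this into [b]. Charging each column to its lowest box reproduces the case split
    in [wA]. *)
Lemma mxA_coef (mu lam : spart) : (ell mu <= n)%N -> (ell lam <= n)%N ->
  spsub mu lam -> ell mu = ell lam -> vertical_strip lam mu ->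
  mxA b n mu lam = 2 ^+ ell mu * (-1) ^+ cols lam mu * (- (c * b)) ^+ skew_size lam mu.
Proof.
move=> mn ln sub el vs; rewrite (cols_rows ln) // (skew_size_rows _ ln) -{1}(sum_row_gt0 mn).
rewrite -!prodrXr -!big_split; apply: eq_bigr => i _ /=.
move/spsubP: sub => /(_ i); move/vertical_stripP: vs => /(_ i).
move/ell_eq_rows: el => /(_ i); have := row_strict lam i; rewrite /wA /new_col /strict0.
move: (row mu i) (row lam i) (row lam i.+1) => u v w h1 h2 h3 h4.
have [e|e] : v = u \/ v = u.+1 by lia.
  subst v; rewrite subnn (ltn_eqF (ltnSn u)) /= !expr0 !mulr1.
  have [u0|u0] := posnP u; first by subst u; split_ifs.
  by split_ifs; rewrite expr1.
have u0 : u != 0%N by lia.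
subst v; rewrite subSnn eqxx u0 /=; split_ifs; rewrite ?expr0 ?expr1;
  by [apply: (lin_comb (c := - b) c2); ring | apply: (lin_comb (c := b) c2); ring].
Qed.

Lemma mxA_eq0 (mu lam : spart) : (ell mu <= n)%N -> (ell lam <= n)%N -> mxA b n mu lam != 0 ->
  [/\ spsub mu lam, ell mu = ell lam & vertical_strip lam mu].
Proof.
move=> mn ln nz.
have h i : [&& row mu i <= row lam i, row lam i <= (row mu i).+1
             & (row mu i == 0) == (row lam i == 0)]%N.
  have [lt|ge] := ltnP i n; last by rewrite !row_eq0 // ?(leq_trans _ ge).
  apply: contraNT nz => h; rewrite /mxA (bigD1 (Ordinal lt)) //= /wA; split_ifs; by rewrite mul0r.
split; [apply/spsubP|apply/ell_eq_rows|apply/vertical_stripP] => i; have /and3P[h1 h2 /eqP h3] := h i => //.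
Qed.

Lemma mxB_coef (kap nu : spart) : (ell kap <= n)%N -> (ell nu <= n)%N ->
  spsub kap nu -> ell kap = ell nu ->
  mxB b n c kap nu = c ^+ ell nu * 2 ^+ overlap nu kap * (- (c * b)) ^+ skew_size nu kap.
Proof.
move=> kn nn sub el; rewrite (overlap_rows nn) // (skew_size_rows _ nn) -{1}(sum_row_gt0 nn).
rewrite -!prodrXr -!big_split; apply: eq_bigr => i _ /=.
move/spsubP: sub => /(_ i); move/ell_eq_rows: el => /(_ i); rewrite /wB.
move: (row kap i) (row nu i) (row nu i.+1) => u v w -> h; rewrite h eqxx /=.
by case: eqP => [v0|_] /=; rewrite ?expr0 ?mul1r ?v0 ?sub0n ?expr0 // mulrAC.
Qed.

Lemma mxB_eq0 (kap nu : spart) : (ell kap <= n)%N -> (ell nu <= n)%N -> mxB b n c kap nu != 0 ->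
  spsub kap nu /\ ell kap = ell nu.
Proof.
move=> kn nn nz.
have h i : [&& row kap i <= row nu i & (row kap i == 0) == (row nu i == 0)]%N.
  have [lt|ge] := ltnP i n; last by rewrite !row_eq0 // ?(leq_trans _ ge).
  by apply: contraNT nz => /negbTE h; rewrite /mxB (bigD1 (Ordinal lt)) //= /wB h mul0r.
by split; [apply/spsubP|apply/ell_eq_rows] => i; have /andP[h1 /eqP h2] := h i.
Qed.

End Coefficients.

(** * Extraction of coefficients by Kronecker substitution *)

Lemma digits_inj D N (c d : nat -> nat) :
  (forall i, c i < D)%N -> (forall i, d i < D)%N ->
  (\sum_(i < N) c i * D ^ i = \sum_(i < N) d i * D ^ i)%N ->
  forall i, (i < N)%N -> c i = d i.
Proof.
elim: N c d => [|N IH] c d cD dD // e.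
have sh (g : nat -> nat) : (\sum_(i < N.+1) g i * D ^ i =
    (\sum_(i < N) g i.+1 * D ^ i) * D + g 0)%N.
  rewrite big_ord_recl expn0 muln1 addnC big_distrl /=; congr addn.
  by apply: eq_bigr => i _; rewrite /bump add1n expnSr mulnA.
move: e; rewrite !sh => e.
have D0 : (0 < D)%N by apply: leq_ltn_trans (cD 0%N).
have e0 : c 0%N = d 0%N.
  by have := congr1 (modn^~ D) e; rewrite !modnMDl !modn_small.
have e1 : (\sum_(i < N) c i.+1 * D ^ i = \sum_(i < N) d i.+1 * D ^ i)%N.
  by apply/eqP; rewrite -(eqn_pmul2r D0); apply/eqP; move: e; rewrite e0 => /addIn.
by case=> [|i] // iN; apply: (IH (fun i => c i.+1) (fun i => d i.+1)).
Qed.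

Lemma lettersum_digits D N (T : filling) :
  (forall b a, a \in T b -> (letter_index a <= N)%N) ->
  lettersum (fun a => D ^ letter_index a)%N T = (\sum_(i < N.+1) tab_mult T i * D ^ i)%N.
Proof.
move=> TN; rewrite /lettersum /tab_mult.
under [RHS]eq_bigr => i _ do rewrite big_distrl /=.
rewrite [RHS]exchange_big /=; apply: eq_bigr => b _.
transitivity (\sum_(a <- T b) \sum_(i < N.+1) (letter_index a == i) * D ^ i)%N.
  rewrite !big_seq; apply: eq_bigr => a aT.
  have iN : (letter_index a < N.+1)%N by rewrite ltnS; apply: TN aT.
  rewrite (bigD1 (Ordinal iN)) //= eqxx mul1n big1 ?addn0 // => i.
  by rewrite -val_eqE /= eq_sym => /negbTE->.
rewrite exchange_big /=; apply: eq_bigr => i _; rewrite -big_distrl /=; congr muln.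
have sub : [fset a in T b | letter_index a == i] `<=` T b.
  by apply/fsubsetP => a; rewrite mem_fset_sep => /andP[].
rewrite card_fset_sum1 -(big_fset_incl _ sub); last first.
  by move=> a aT; rewrite mem_fset_sep aT /= => /negbTE->.
by rewrite !big_seq; apply: eq_bigr => a; rewrite mem_fset_sep => /andP[_ ->].
Qed.

Lemma tab_mult_le (T : filling) i : (tab_mult T i <= tab_size T)%N.
Proof.
apply: leq_sum => b _; apply: fsubset_leq_card; apply/fsubsetP => a.
by rewrite mem_fset_sep => /andP[].
Qed.

Lemma leq_sum_mem (I : eqType) (s : seq I) (F : I -> nat) x : x \in s -> (F x <= \sum_(y <- s) F y)%N.
Proof. by move=> xs; rewrite (big_rem x) //= leq_addr. Qed.

(* Kronecker substitution x_i = 'X^(D^i): when D exceeds all multiplicities, a monomial is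
   recovered from the base-D digits of the exponent of 'X. *)
Lemma coef_mxtab P n B N D mu nu (m : monom) : (ell mu <= n)%N -> (row mu 0 <= B)%N ->
  (forall T, T \in tabs n B P nu N.*2 mu -> (tab_size T < D)%N) ->
  (forall i, m i < D)%N -> (forall i, i \in finsupp m -> (i <= N)%N) ->
  (mxtab beta%:P 'X (fun a => D ^ letter_index a)%N n B P N.*2 mu nu)`_(\sum_(i < N.+1) m i * D ^ i)%N =
  (if P then GPP mu nu else GQQ mu nu) m.
Proof.
move=> mn mB TD mD mN.
rewrite (coef_doubleslash (K := N.*2) P nu mn mB); last by move=> i /mN; rewrite leq_double.
rewrite /mxtab /tabsum coef_sum [RHS]big_mkcond big_seq [RHS]big_seq; apply: eq_bigr => T TT.
have g : gtab P N.*2 mu nu T by apply/(tabsP _ _ _ _ mn mB).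
have TN b a : a \in T b -> (letter_index a <= N)%N.
  by case: b => i j /(gtab_letter g); rewrite /letter_index; lia.
rewrite /tabweight -polyC_exp coefCM coefXn (lettersum_digits D TN).
have -> : (\sum_(i < N.+1) m i * D ^ i == \sum_(i < N.+1) tab_mult T i * D ^ i)%N = `[< has_monom T m >].
  apply/eqP/asboolP => [e i|hm]; last by apply: eq_bigr => i _; rewrite hm.
  have [lt|ge] := ltnP i N.+1.
    apply: (digits_inj (D := D) (N := N.+1) (d := tab_mult T)) => // k.
    exact: leq_ltn_trans (tab_mult_le T k) (TD _ TT).
  have -> : m i = 0%N.
    by apply/eqP; apply: contraTT ge; rewrite -mem_finsupp => /mN; rewrite -leqNgt.
  rewrite /tab_mult big1 // => b _; apply/eqP; rewrite cardfs_eq0 -fsubset0; apply/fsubsetP => a.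
  by rewrite mem_fset_sep => /andP[/TN le /eqP ai]; rewrite ai leqNgt ge in le.
by case: asbool; rewrite ?mulr1 ?mulr0.
Qed.

Section Morphism.
Variables (R S : comNzRingType) (phi : {rmorphism R -> S}) (b c : R) (n : nat).

(** Applied to the constant embedding of [{poly rat}], this makes the entries of [A] constants in
    the auxiliary variable, so they pass through coefficient extraction. *)
Lemma rmorph_mxA mu lam : phi (mxA b n mu lam) = mxA (phi b) n mu lam.
Proof.
rewrite rmorph_prod; apply: eq_bigr => i _; rewrite /wA.
by do ![case: ifP => _]; rewrite ?rmorph0 ?rmorph1 ?rmorphN ?rmorph_nat.
Qed.

Lemma rmorph_mxB kap nu : phi (mxB b n c kap nu) = mxB (phi b) n (phi c) kap nu.
Proof.
rewrite rmorph_prod; apply: eq_bigr => i _; rewrite /wB.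
by do ![case: ifP => _]; rewrite ?rmorph0 ?rmorph1 // !rmorphM !rmorphXn rmorphN rmorphM rmorph_nat.
Qed.

End Morphism.

(** * The expansion of [GQQ] *)

Unset Implicit Arguments.

Theorem theorem5p3 (mu nu : spart) (h : spsub nu mu) :
  GQQ mu nu =
  \sum_(kl \in expansion_pairs mu nu)
     (2 ^+ (ell mu - ell nu + overlap nu kl.1)
      * (-1) ^+ cols kl.2 mu
      * (- (2^-1 *: beta)) ^+ (skew_size nu kl.1 + skew_size kl.2 mu))
     *: GPP kl.2 kl.1.
Proof.
(* The length of [lam] equals that of [mu], and a vertical strip adds at most one box to the first
   row, so this box contains every index of the sum. *)
pose n := ell mu; pose B := (row mu 0).+1; pose U := sparts B n.
have mn : (ell mu <= n)%N by [].
have lnm : (ell nu <= ell mu)%N.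
  by rewrite leqNgt -row_gt0 -leqNgt; have /spsubP/(_ (ell mu)) := h; rewrite (row_eq0 (leqnn _)).
have nuU : nu \in U.
  by rewrite mem_sparts lnm andbT leqW //; have /spsubP := h.
pose c : {poly rat} := (2^-1)%:P.
have c2 : 2 * c = 1 by rewrite /c -[2]polyC_natr -polyCM divff.
have cb : 2^-1 *: beta = c * beta by rewrite mul_polyC.
pose r := [seq kl <- [seq (kap, lam) | kap <- U, lam <- U] | `[< expansion_pairs mu nu kl >]].
have rE : expansion_pairs mu nu = [set` r].
  apply/seteqP; split=> -[kap lam]; rewrite /= mem_filter; last by case/andP => /asboolP.
  move=> hkl; apply/andP; split; first exact/asboolP.
  case: hkl => [[/= s1 _ s2] [e1 _ e2 /vertical_stripP vs]].
  apply/allpairsP; exists (kap, lam); rewrite /= !mem_sparts -e2 leqnn e1 lnm !andbT; split=> //.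
    by apply: leq_trans (leqW (leqnn _)); have /spsubP/(_ 0%N) k1 := s1; have /spsubP/(_ 0%N) := h; lia.
have ur : uniq r.
  apply/filter_uniq/allpairs_uniq; try exact: uniq_sparts.
  by move=> [k l] [k' l'] _ _ [-> ->].
rewrite rE -fsbig_seq //; apply/funext => m; rewrite fct_sumE.
pose N := \max_(i <- finsupp m) i.
have mN i : i \in finsupp m -> (i <= N)%N by move=> im; rewrite /N (big_fsetD1 i) //= leq_maxl.
(* The base exceeds every exponent of [m] and the size of every tableau involved, so no carries
   occur between digits. *)
pose D := (\sum_(i <- finsupp m) m i + \sum_(P <- [:: true; false]) \sum_(lam <- U) \sum_(kap <- U)
   \sum_(T <- tabs n B P kap N.*2 lam) tab_size T)%N.+1.
have mD i : (m i < D)%N.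
  rewrite ltnS; case: (finsuppP m i) => [_|im]; first exact: leq0n.
  by apply: leq_trans (leq_addr _ _); exact: (leq_sum_mem m).
have TD P lam kap T : lam \in U -> kap \in U -> T \in tabs n B P kap N.*2 lam -> (tab_size T < D)%N.
  move=> lU kU TT; rewrite ltnS; apply: leq_trans (leq_addl _ _).
  apply: leq_trans (leq_sum_mem _ (_ : P \in _)); last by case: P TT.
  apply: leq_trans (leq_sum_mem _ lU); apply: leq_trans (leq_sum_mem _ kU).
  exact: leq_sum_mem.
have muU : mu \in U by rewrite mem_sparts leqW.
have UE lam : lam \in U -> (row lam 0 <= B)%N /\ (ell lam <= n)%N.
  by rewrite mem_sparts => /andP.
have coefE P lam kap : lam \in U -> kap \in U -> (if P then GPP lam kap else GQQ lam kap) m =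
    (mxtab beta%:P 'X (fun a => D ^ letter_index a)%N n B P N.*2 lam kap)`_(\sum_(i < N.+1) m i * D ^ i)%N.
  by move=> lU kU; have [lB ln] := UE _ lU; rewrite (coef_mxtab ln lB) // => T; apply: TD.
have fp i : (D ^ letter_index i.*2.+1 = D ^ letter_index i.*2.+2)%N.
  by congr expn; rewrite /letter_index; lia.
have c2' : 2 * c%:P = 1 :> {poly {poly rat}} by rewrite -[2]polyC_natr -polyCM c2.
rewrite (coefE false) // (mxtab_expand beta%:P 'X fp N c2') //.
rewrite coef_sum; under eq_bigr do rewrite coef_sum.
rewrite /r [RHS]big_filter [RHS]big_mkcond [RHS]big_allpairs_dep /= [RHS]exchange_big /=.
rewrite big_seq [RHS]big_seq; apply: eq_bigr => lam lU.
rewrite big_seq [RHS]big_seq; apply: eq_bigr => kap kU.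
have [lB ln] := UE _ lU; have [kB kn] := UE _ kU; have [nB nn] := UE _ nuU.
rewrite -rmorph_mxA -rmorph_mxB -rmorphM coefCM -(coefE true) //.
case: asboolP => [[[/= s1 _ s2] [e1 _ e2 vs]]|ne].
  rewrite fps_scaleE; congr (_ * _).
  (* [A] supplies one factor 2 per part of [mu] and [B] one factor [c] per part of [nu]; the
     truncated subtraction is exact by [lnm]. *)
  have key : 2 ^+ (ell mu - ell nu) = 2 ^+ ell mu * c ^+ ell nu.
    by rewrite -[in RHS](subnK lnm) [in RHS]exprD -mulrA -exprMn c2 expr1n mulr1.
  rewrite (mxA_coef beta c2) // (mxB_coef beta) // cb !(exprD _ _ _) key.
  move: (2 ^+ ell mu) (c ^+ ell nu) (2 ^+ overlap nu kap) ((-1) ^+ cols lam mu)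
    ((- (c * beta)) ^+ skew_size nu kap) ((- (c * beta)) ^+ skew_size lam mu).
  by move=> *; ring.
(* Outside the index set the entry of [A] or that of [B] vanishes. *)
apply/eqP; rewrite mulf_eq0; apply/orP; left; apply: contra_notT ne.
rewrite mulf_eq0 negb_or => /andP[/(mxA_eq0 mn ln)[s2 e2 vs] /(mxB_eq0 kn nn)[s1 e1]].
by split.
Qed.
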